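(* Let $\phi=\psi^{-1}:\psi(U)\to\mathbb{R}^r$ be the inverse of a chart $\psi:U\to\mathbb{R}^n$ of an $n$-dimensional submanifold $M\subseteq\mathbb{R}^r$, and consider the It\^o SDEs $$dX_t=a(X_t,t)\,dt+b_\alpha(X_t,t)\,dW^\alpha_t,\quad X_0\in U,\qquad\qquad dY_t=A(Y_t,t)\,dt+B_\alpha(Y_t,t)\,dW^\alpha_t,\quad Y_0=\psi(X_0),$$ on $\mathbb{R}^r$ and on $\psi(U)\subseteq\mathbb{R}^n$ respectively, where $a,b_\alpha$ are given and $X_0$ is deterministic. Fix any time $t>0$. (1) In order that the coefficients of the second SDE at time $0$ minimize $E(|\cdot|^2)$ of the order $\frac12$ It\^o--Taylor expansion of $X_t-\phi(Y_t)$, one must take, for every $\alpha$, $$B_\alpha(Y_0,0)=(\psi_* )_{X_0}\,\Pi_{X_0}\,b_\alpha(X_0,0).$$ (2) Suppose that $B$ is chosen so that this minimum is achieved at all points of $U$ (i.e. the analogous formula $B_\alpha(y,0)=(\psi_* )_{\phi(y)}\Pi_{\phi(y)}b_\alpha(\phi(y),0)$ holds at all $y\in\psi(U)$). Then $E(|\cdot|^2)$ of the order $1$ It\^o--Taylor expansion of $X_t-\phi(Y_t)$ is minimized by taking $$A(Y_0,0)=(\psi_* )_{X_0}\,\Pi_{X_0}\Big(a(X_0,0)-\tfrac12\big(\nabla_{B_\alpha(Y_0,0)}\phi_*\big)B_\beta(Y_0,0)\,g_E^{\alpha\beta}\Big).$$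
   Context: Einstein summation is used. $W^1,\dots,W^m$ are independent standard Brownian motions; $g_E^{\alpha\beta}=\delta^{\alpha\beta}$. $U$ is an open neighbourhood in $M$. For $x\in M$, $\Pi_x:\mathbb{R}^r\to T_xM$ is the Euclidean orthogonal projection; $\phi_*$ is the differential of $\phi$; $(\psi_* )_x:T_xM\to\mathbb{R}^n$ is the differential of $\psi$ (the inverse of $\phi_*$ onto $T_xM$). For a smooth map $F$ and vectors $v,w$, $(\nabla_vF_* )w=v^iw^j\,\partial_i\partial_jF$ (second derivative of $F$ applied to $v,w$). It\^o--Taylor expansions: consider an SDE $dZ_t=a(Z_t,t)dt+b_\alpha(Z_t,t)dW^\alpha_t$ (for functions of a pair such as $(X_t,Y_t)$, apply the following to the stacked SDE driven by the same Brownian motions). A multi-index $\xi$ is a finite (possibly empty) list of integers in $\{0,\dots,m\}$; $l(\xi)$ is its length, $n(\xi)$ its number of zeros; $\xi_1,\xi_{-1}$ are its first and last entries, $-\xi$ and $\xi-$ the result of deleting the first, respectively last, entry. Put $W^0_t=t$. Define $I^{()}_{t_1,t_2}(f)=f(t_2)$ and $I^\xi_{t_1,t_2}(f)=\int_{t_1}^{t_2}I^{\xi-}_{t_1,s}(f)\,dW^{\xi_{-1}}_s$ otherwise. Define $L_{()}f=f$, $L_{(0)}f=\frac{\partial f}{\partial t}+a^i\frac{\partial f}{\partial x^i}+\frac12b^i_\alpha b^j_\beta g_E^{\alpha\beta}\frac{\partial^2f}{\partial x^i\partial x^j}$, $L_{(\alpha)}f=b^i_\alpha\frac{\partial f}{\partial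 x^i}$ for $\alpha\ge1$, and $L_\xi f=L_{(\xi_1)}(L_{-\xi}f)$ for $l(\xi)>1$. The It\^o--Taylor expansion of order $\gamma\in\{0,\frac12,1,\dots\}$ of $f(Z_t)$ (based at time $0$) is $\sum_{l(\xi)+n(\xi)\le2\gamma}(L_\xi f)|_{(0,Z_0)}\,I^\xi_{0,t}(1)$. All derivatives needed for the expansions are assumed to exist. *)

(* Defs.v *)
(* Vectors are row vectors: the linear map with matrix J is  v |-> v *m J. *)
From HB Require Import structures.
From mathcomp Require Import all_boot all_order all_algebra.
From mathcomp Require Import all_classical all_reals all_analysis.

Set Implicit Arguments.
Unset Strict Implicit.
Unset Printing Implicit Defensive.

Import Order.TTheory GRing.Theory Num.Theory numFieldNormedType.Exports.

Local Open Scope classical_set_scope.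
Local Open Scope ring_scope.

(* Processes and filtrations are indexed by all of [R], but only their values
   at times [0 <= t] matter. *)

Section Brownian.
Context {d : measure_display} {T : measurableType d} {R : realType}.
Variable P : probability T R.

(* Every [G j] is meant to contain [setT], so that the product rule for the
   full family implies the product rule for every subfamily. *)
Definition independent_systems (J : finType) (G : J -> set (set T)) :=
  forall A : J -> set T, (forall j, G j (A j)) ->
    P (\bigcap_(j in [set: J]) A j) = (\prod_(j : J) fine (P (A j)))%:E.

Definition sigma_var (X : T -> R) : set (set T) :=
  @g_sigma_algebra_preimage _ T (measurableTypeR R) X.

Definition sigma_process (B : R -> T -> R) : set (set T) :=
  <<s \bigcup_(t in `[0, +oo[) sigma_var (B t) >>.

Definition standard_brownian (B : R -> T -> R) : Prop :=
  [/\ forall t, 0 <= t -> measurable_fun [set: T] (B t),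
      {ae P, forall w, B 0 w = 0},
      forall s t, 0 <= s -> s < t -> forall C : set R, measurable C ->
        P ((B t \- B s) @^-1` C) = normal_prob 0 (Num.sqrt (t - s)) C,
      forall (k : nat) (u : nat -> R), 0 <= u 0%N ->
        (forall i, u i <= u i.+1) ->
        independent_systems
          (fun i : 'I_k => sigma_var (B (u i.+1) \- B (u i)))
    & {ae P, forall w, {within `[0, +oo[, continuous (B ^~ w)}}].

Definition independent_brownian_motions m (W : 'I_m -> R -> T -> R) : Prop :=
  (forall al, standard_brownian (W al)) /\
  independent_systems (fun al => sigma_process (W al)).

Definition filtration (F : R -> set (set T)) : Prop :=
  [/\ forall t, 0 <= t -> sigma_algebra [set: T] (F t),
      forall t, 0 <= t -> F t `<=` measurable
    & forall s t, 0 <= s -> s <= t -> F s `<=` F t].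

(* [F] may be larger than the filtration generated by [W] (for instance its
   completion), as long as increments stay independent of the past. *)
Definition brownian_filtration m (F : R -> set (set T))
    (W : 'I_m -> R -> T -> R) : Prop :=
  [/\ filtration F,
      forall al t, 0 <= t -> sigma_var (W al t) `<=` F t
    & forall s t, 0 <= s -> s <= t -> forall A C : set T, F s A ->
        <<s \bigcup_(al in [set: 'I_m])
              sigma_var (W al t \- W al s) >> C ->
        P (A `&` C) = (P A * P C)%E].

End Brownian.

Section ItoIntegral.
Context {d : measure_display} {T : measurableType d} {R : realType}.
Variable P : probability T R.
Variable F : R -> set (set T).

(* The step process equal to [sp_coef i] on ](sp_node i), (sp_node i.+1)]. *)
Record simple_process (t1 t2 : R) := SimpleProcess {
  sp_size : nat ;
  sp_node : nat -> R ;
  sp_coef : nat -> T -> R ;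
  sp_node_first : sp_node 0%N = t1 ;
  sp_node_last : sp_node sp_size = t2 ;
  sp_node_le : forall i, (i < sp_size)%N -> sp_node i <= sp_node i.+1 ;
  sp_coef_meas : forall i, (i < sp_size)%N ->
    sigma_var (sp_coef i) `<=` F (sp_node i) ;
  sp_coef_bnd : forall i, (i < sp_size)%N ->
    exists C : R, forall w, `|sp_coef i w| <= C }.

Definition simple_value t1 t2 (S : simple_process t1 t2) (s : R) (w : T) : R :=
  \sum_(i < sp_size S)
    sp_coef S i w * \1_(`](sp_node S i), (sp_node S i.+1)]) s.

Definition simple_integral t1 t2 (S : simple_process t1 t2)
    (B : R -> T -> R) (w : T) : R :=
  \sum_(i < sp_size S)
    sp_coef S i w * (B (sp_node S i.+1) w - B (sp_node S i) w).

Definition mean_square (t1 t2 : R) (H : R -> T -> R) : \bar R :=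
  (\int[P]_w \int[lebesgue_measure]_(s in `[t1, t2]) ((H s w) ^+ 2)%:E)%E.

Definition ito_integrand (t1 t2 : R) (H : R -> T -> R) : Prop :=
  [/\ measurable_fun (`[t1, t2]%classic `*` [set: T])
        (fun sw : measurableTypeR R * T => H sw.1 sw.2),
      forall s, t1 <= s <= t2 -> sigma_var (H s) `<=` F s
    & (mean_square t1 t2 H < +oo)%E].

(* The usual L^2 construction; since an Ito integral is defined only up to a
   null set, it is given by a relation: [Z] is a version of the integral of [H]
   against [B] over [t1, t2]. *)
Definition is_ito_integral (B : R -> T -> R) (t1 t2 : R)
    (H : R -> T -> R) (Z : T -> R) : Prop :=
  [/\ ito_integrand t1 t2 H, measurable_fun [set: T] Z &
      exists S : nat -> simple_process t1 t2,
        (fun k => mean_square t1 t2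
           (fun s w => simple_value (S k) s w - H s w)) @ \oo --> 0%E /\
        (fun k => 'E_P[fun w => ((simple_integral (S k) B w - Z w) ^+ 2)%R]%E)
          @ \oo --> 0%E].

Definition is_time_integral (t1 t2 : R) (H : R -> T -> R) (Z : T -> R) : Prop :=
  [/\ ito_integrand t1 t2 H, measurable_fun [set: T] Z &
      {ae P, forall w,
         Z w = \int[lebesgue_measure]_(s in `[t1, t2]) H s w}].

(* Multi-indices are [seq 'I_m.+1]: the entry [ord0] stands for the time
    W^0_t = t, the entry [lift ord0 al] for the Brownian motion [W al]. *)

Definition is_integral_dW m (W : 'I_m -> R -> T -> R) (i : 'I_m.+1) t1 t2 H Z :=
  match unlift ord0 i with
  | None => is_time_integral t1 t2 H Z
  | Some al => is_ito_integral (W al) t1 t2 H Z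
  end.

(* [I xi t1 t2] is a version of the iterated integral of the process [f] with
   multi-index [xi]; the last entry of [xi] is the outermost integrator. *)
Definition is_iterated_integrals m (W : 'I_m -> R -> T -> R) (f : R -> T -> R)
    (I : seq 'I_m.+1 -> R -> R -> T -> R) : Prop :=
  (forall t1 t2, I [::] t1 t2 = f t2) /\
  (forall xi i t1 t2, 0 <= t1 -> t1 <= t2 ->
     is_integral_dW W i t1 t2 (I xi t1) (I (rcons xi i) t1 t2)).

End ItoIntegral.

Section ItoTaylor.
Context {R : realType}.

(* The SDE  dZ_t = drift(Z_t,t) dt + diffusion_al(Z_t,t) dW^al_t. *)
Record sde (m p : nat) := SDE {
  drift : 'rV[R]_p -> R -> 'rV[R]_p ;
  diffusion : 'I_m -> 'rV[R]_p -> R -> 'rV[R]_p }.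

Definition stacked_sde m p q (X : sde m p) (Y : sde m q) : sde m (p + q) :=
  SDE (fun z t => row_mx (drift X (lsubmx z) t) (drift Y (rsubmx z) t))
      (fun al z t =>
         row_mx (diffusion X al (lsubmx z) t) (diffusion Y al (rsubmx z) t)).

Definition gE m (al be : 'I_m) : R := (al == be)%:R.

Definition partial p q (i : 'I_p) (f : 'rV[R]_p -> 'rV[R]_q) :
  'rV[R]_p -> 'rV[R]_q := fun z => 'D_('e_i) f z.

Definition ito_L1 m p q (S : sde m p) (i : 'I_m.+1)
    (f : 'rV[R]_p -> R -> 'rV[R]_q) : 'rV[R]_p -> R -> 'rV[R]_q :=
  match unlift ord0 i with
  | None => fun z t =>
      'D_1 (f z) t
      + \sum_j drift S z t 0 j *: partial j (f ^~ t) z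
      + 2^-1 *: \sum_j \sum_k \sum_al \sum_be
          (diffusion S al z t 0 j * diffusion S be z t 0 k * gE al be)
            *: partial j (partial k (f ^~ t)) z
  | Some al => fun z t => \sum_j diffusion S al z t 0 j *: partial j (f ^~ t) z
  end.

Definition ito_L m p q (S : sde m p) (xi : seq 'I_m.+1)
    (f : 'rV[R]_p -> R -> 'rV[R]_q) : 'rV[R]_p -> R -> 'rV[R]_q :=
  foldr (ito_L1 S) f xi.

(* The expansion of order [k]/2 of [f(Z_t)], based at time 0 with Z_0 = z0;
   [I] are the iterated integrals of the constant process 1. *)
Definition ito_taylor (T : Type) m p q
    (I : seq 'I_m.+1 -> R -> R -> T -> R) (S : sde m p) (z0 : 'rV[R]_p)
    (f : 'rV[R]_p -> R -> 'rV[R]_q) (k : nat) (t : R) (w : T) : 'rV[R]_q :=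
  \sum_(l < k.+1)
    \sum_(xi : l.-tuple 'I_m.+1 | (l + count_mem ord0 xi <= k)%N)
      I xi 0 t w *: ito_L S xi f z0 0.

Definition sqnorm p (v : 'rV[R]_p) : R := \sum_i v 0 i ^+ 2.

End ItoTaylor.

Section Submanifold.
Context {R : realType}.

Fixpoint Ck_on (k : nat) p q (V : set 'rV[R]_p) (f : 'rV[R]_p -> 'rV[R]_q) :
    Prop :=
  match k with
  | 0 => forall y, V y -> {for y, continuous f}
  | k'.+1 => (forall y, V y -> differentiable f y) /\
             (forall i : 'I_p, Ck_on k' V (partial i f))
  end.

Definition smooth_on p q (V : set 'rV[R]_p) (f : 'rV[R]_p -> 'rV[R]_q) : Prop :=
  forall k, Ck_on k V f.

(* [psi] is a chart with domain [U] of the subset [M] of R^r and [phi] is its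
   inverse; both are total functions used only on [U] and on [psi @` U]. *)
Record is_chart r n (M U : set 'rV[R]_r) (psi : 'rV[R]_r -> 'rV[R]_n)
    (phi : 'rV[R]_n -> 'rV[R]_r) : Prop := IsChart {
  chart_dom_open : exists2 O : set 'rV[R]_r, open O & U = M `&` O ;
  chart_img_open : open (psi @` U) ;
  chart_continuous : {within U, continuous psi} ;
  chart_inv_smooth : smooth_on (psi @` U) phi ;
  chart_inv : forall x, U x -> phi (psi x) = x ;
  chart_immersion : forall y, (psi @` U) y -> row_free ('J phi y) }.

Definition submanifold r (n : nat) (M : set 'rV[R]_r) : Prop :=
  forall x, M x ->
    exists (U : set 'rV[R]_r) (psi : 'rV[R]_r -> 'rV[R]_n)
           (phi : 'rV[R]_n -> 'rV[R]_r), U x /\ is_chart M U psi phi.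

(* T_xM at x = phi y, as the row space of a square matrix: it is the image of
   the differential  v |-> v *m 'J phi y. *)
Definition tangent_space r n (phi : 'rV[R]_n -> 'rV[R]_r) (y : 'rV[R]_n) :
  'M[R]_r := <<'J phi y>>%MS.

(* The row space of [kermx E^T] is the Euclidean orthogonal complement of the
   row space of [E]. *)
Definition orth_proj r (E : 'M[R]_r) (v : 'rV[R]_r) : 'rV[R]_r :=
  v *m proj_mx E (kermx E^T).

(* The inverse of phi_* on T_xM, x = phi y; only to be applied to elements of
   [tangent_space phi y], outside of which its value is meaningless. *)
Definition psi_star r n (phi : 'rV[R]_n -> 'rV[R]_r) (y : 'rV[R]_n)
    (v : 'rV[R]_r) : 'rV[R]_n := v *m pinvmx ('J phi y).

Definition nabla_diff p q (F : 'rV[R]_p -> 'rV[R]_q) (y v w : 'rV[R]_p) :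
    'rV[R]_q :=
  \sum_i \sum_j (v 0 i * w 0 j) *: partial i (partial j F) y.

End Submanifold.

(* Main.v *)
Require Import Defs.
From HB Require Import structures.
From mathcomp Require Import all_boot all_order all_algebra.
From mathcomp Require Import all_classical all_reals all_analysis.
From mathcomp Require Import measurable_realfun ring lra.

Set Implicit Arguments.
Unset Strict Implicit.
Unset Printing Implicit Defensive.

Import Order.TTheory GRing.Theory Num.Theory numFieldNormedType.Exports.

Local Open Scope classical_set_scope.
Local Open Scope ring_scope.

(** Stack the two equations into a single one for the pair [(X, Y)] and put
    [gap (x, y) = x - phi y], which vanishes at the starting point. The
    coefficients [L_xi gap] of the expansion are deterministic vectors, so the
    expansion is a combination of fixed vectors weighted by the iterated
    integrals [I^xi] of 1, and every [I^xi] whose last index is a noise index has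
    mean 0 ([iterated_integral_centered]), because it is a mean-square limit of
    sums of adapted coefficients times independent centred increments.

    Let [J] be the Jacobian matrix of [phi] at [Y0]; the tangent space is its row
    space.

    At order 1/2 only the single noise indices contribute, and the expansion is
    [sum_al I^al (b_al - B_al J)] ([ito_gap_noise]). The [I^al] are almost surely
    the increments of the [W^al] over [[0, t]] ([noise_integral]), hence pairwise
    orthogonal with positive variances [c_al], and the mean square is
    [sum_al c_al |b_al - B_al J|^2] ([expectation_sqnorm_orthogonal]). The terms
    decouple: for every [al] one has to approximate [b_al] by a vector [u J] of
    the tangent space. By Pythagoras ([sqnorm_sub_proj]) the best such vector is
    the orthogonal projection of [b_al], and it has a single preimage [u] since
    the rows of [J] are independent.

    At order 1 the drift [A] occurs only in the term of index [(0)], whose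
    iterated integral is the constant [t] and whose coefficient is [v - A J], with
    [v = a - 1/2 nabla phi (B, B)] ([ito_gap_drift]). All other terms have mean 0
    and are the same for every [A] ([ito_L_diffusion]); the mean square is thus
    [t^2 |v - A J|^2] plus a constant ([expectation_sqnorm_centered]), and the
    same projection argument applies to [v].

    The minimizers are the same for all positive weights [c_al], so the variance
    of a Brownian increment [D] over [[s, t]] with [s < t] only enters through
    [0 < E D^2 <= 8 (t - s)]: the upper bound makes the stochastic integral of
    step processes continuous in mean square, which identifies [I^al], and the
    lower one gives uniqueness. *)

(** * Least squares by orthogonal projection *)

Section Projection.
Context {R : realType}.

Lemma sqnormE p (v : 'rV[R]_p) : sqnorm v = (v *m v^T) 0 0.
Proof. by rewrite mxE; apply: eq_bigr => i _; rewrite mxE expr2. Qed.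

Lemma sqnorm_ge0 p (v : 'rV[R]_p) : 0 <= sqnorm v.
Proof. by apply: sumr_ge0 => i _; rewrite sqr_ge0. Qed.

Lemma sqnorm_eq0 p (v : 'rV[R]_p) : (sqnorm v == 0) = (v == 0).
Proof.
apply/idP/eqP => [|->]; last by rewrite /sqnorm big1// => i _; rewrite mxE expr0n.
rewrite psumr_eq0 => [/allP v0|i _]; last exact: sqr_ge0.
apply/rowP => i; rewrite mxE; apply/eqP; rewrite -sqrf_eq0.
exact: (v0 i (mem_index_enum i)).
Qed.

Lemma sqnormZ p (k : R) (v : 'rV[R]_p) : sqnorm (k *: v) = k ^+ 2 * sqnorm v.
Proof. by rewrite /sqnorm mulr_sumr; apply: eq_bigr => i _; rewrite mxE exprMn. Qed.

Lemma sqnormD_orth p (u v : 'rV[R]_p) :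
  u *m v^T = 0 -> sqnorm (u + v) = sqnorm u + sqnorm v.
Proof.
move=> uv; have vu : v *m u^T = 0 by rewrite -[LHS]trmxK trmx_mul trmxK uv trmx0.
by rewrite !sqnormE linearD /= mulmxDl !mulmxDr uv vu addr0 add0r mxE.
Qed.

(** A vector of [E] orthogonal to [E] is orthogonal to itself, so its squared
    norm, a sum of squares, is 0. *)
Lemma cap_orth r (E : 'M[R]_r) : (E :&: kermx E^T)%MS = 0.
Proof.
apply/eqP; rewrite -submx0; apply/row_subP => i; set v := row i _.
have : (v <= E :&: kermx E^T)%MS by exact: row_sub.
rewrite sub_capmx => /andP[/submxP[w vE] /sub_kermxP vET].
by rewrite submx0 -sqnorm_eq0 sqnormE {2}vE trmx_mul mulmxA vET mul0mx mxE.
Qed.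

(** The two subspaces meet trivially and their dimensions add up to [r], so
    every vector splits along them. *)
Lemma orth_proj_compl r (E : 'M[R]_r) (v : 'rV[R]_r) :
  (v - orth_proj E v) *m E^T = 0.
Proof.
apply/sub_kermxP/proj_mx_compl_sub/submx_full.
apply/eqP; have := mxrank_sum_cap E (kermx E^T).
by rewrite cap_orth mxrank0 addn0 mxrank_ker mxrank_tr subnKC// rank_leq_row.
Qed.

(** Pythagoras: [v] minus its projection is orthogonal to the tangent space,
    which contains both [u *m J] and the projection [u0 *m J]. *)
Lemma sqnorm_sub_proj r n (phi : 'rV[R]_n -> 'rV[R]_r) (y u : 'rV[R]_n)
    (v : 'rV[R]_r) (u0 := psi_star phi y (orth_proj (tangent_space phi y) v)) :
  sqnorm (v - u *m 'J phi y) =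
  sqnorm (v - u0 *m 'J phi y) + sqnorm ((u0 - u) *m 'J phi y).
Proof.
have -> : v - u *m 'J phi y = v - u0 *m 'J phi y + (u0 - u) *m 'J phi y.
  by rewrite mulmxBl addrA subrK.
apply: sqnormD_orth; rewrite trmx_mul mulmxA.
have JE : ('J phi y <= tangent_space phi y)%MS by rewrite genmxE.
have u0J : u0 *m 'J phi y = orth_proj (tangent_space phi y) v.
  by rewrite mulmxKpV// (submx_trans (proj_mx_sub _ _ _))// genmxE.
rewrite u0J; have /submxP[D ->] := JE.
by rewrite trmx_mul mulmxA orth_proj_compl !mul0mx.
Qed.

Lemma sqnorm_sub_proj_le r n (phi : 'rV[R]_n -> 'rV[R]_r) (y u : 'rV[R]_n)
    (v : 'rV[R]_r) (u0 := psi_star phi y (orth_proj (tangent_space phi y) v)) :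
  sqnorm (v - u0 *m 'J phi y) <= sqnorm (v - u *m 'J phi y).
Proof. by rewrite (sqnorm_sub_proj phi y u) lerDl sqnorm_ge0. Qed.

(** The minimizer is unique because the rows of the Jacobian are
    independent, so that distinct [u] give distinct tangent vectors. *)
Lemma sqnorm_sub_proj_uniq r n (phi : 'rV[R]_n -> 'rV[R]_r) (y u : 'rV[R]_n)
    (v : 'rV[R]_r) (u0 := psi_star phi y (orth_proj (tangent_space phi y) v)) :
  row_free ('J phi y) ->
  sqnorm (v - u *m 'J phi y) <= sqnorm (v - u0 *m 'J phi y) -> u = u0.
Proof.
move=> Jfree; rewrite (sqnorm_sub_proj phi y u) gerDl => le0.
have : sqnorm ((u0 - u) *m 'J phi y) == 0 by rewrite eq_le le0 sqnorm_ge0.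
by rewrite sqnorm_eq0 mulmx_free_eq0// subr_eq0 => /eqP.
Qed.

End Projection.

(** * Derivatives of the gap between the two solutions *)

Section Gap.
Context {R : realType} {r n : nat}.
Variables (phi : 'rV[R]_n -> 'rV[R]_r).

Let gap (z : 'rV[R]_(r + n)) := lsubmx z - phi (rsubmx z).

(** Both sides are limits of the same difference quotient, so the identity holds
    even where the derivative does not exist. *)
Lemma derive_comp_rsubmx q (h : 'rV[R]_n -> 'rV[R]_q) (z v : 'rV[R]_(r + n)) :
  'D_v (fun z => h (rsubmx z)) z = 'D_(rsubmx v) h (rsubmx z).
Proof.
rewrite /derive.
by under eq_fun do rewrite /= [rsubmx (_ + _)]linearD /= [rsubmx (_ *: _)]linearZ.
Qed.

Lemma derivable_comp_rsubmx q (h : 'rV[R]_n -> 'rV[R]_q) (z v : 'rV[R]_(r + n)) :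
  derivable h (rsubmx z) (rsubmx v) -> derivable (fun z => h (rsubmx z)) z v.
Proof.
rewrite /derivable => dh.
by under eq_fun do rewrite /= [rsubmx (_ + _)]linearD /= [rsubmx (_ *: _)]linearZ.
Qed.

Lemma derive_gap (z v : 'rV[R]_(r + n)) : differentiable phi (rsubmx z) ->
  'D_v gap z = lsubmx v - 'D_(rsubmx v) phi (rsubmx z).
Proof.
move=> dphi; rewrite /gap deriveB.
- rewrite derive_comp_rsubmx deriveE; last exact: differentiable_lsubmx.
  by rewrite diff_lin//; exact: continuous_lsubmx.
- exact/diff_derivable/differentiable_lsubmx.
- by apply: derivable_comp_rsubmx; exact: diff_derivable.
Qed.

(** The formula for the first derivative is valid on a neighbourhood of [z], as [V]
    is open, and may therefore be differentiated again; the contribution of the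
    linear part [lsubmx] is constant. *)
Lemma derive2_gap (V : set 'rV[R]_n) (z u v : 'rV[R]_(r + n)) :
  open V -> V (rsubmx z) -> (forall y, V y -> differentiable phi y) ->
  derivable ('D_(rsubmx v) phi) (rsubmx z) (rsubmx u) ->
  'D_u ('D_v gap) z = - 'D_(rsubmx u) ('D_(rsubmx v) phi) (rsubmx z).
Proof.
move=> oV Vz dphi d2.
have nearV : \forall z' \near z,
    'D_v gap z' = lsubmx v - 'D_(rsubmx v) phi (rsubmx z').
  suff : \forall z' \near z, V (rsubmx z').
    by apply: filterS => z' Vz'; apply: derive_gap; exact: dphi.
  have : {for z, continuous (@rsubmx R 1 r n)} by exact: continuous_rsubmx.
  by apply; exact: open_nbhs_nbhs.
rewrite (near_eq_derive _ nearV) deriveB.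
- by rewrite derive_cst sub0r (derive_comp_rsubmx ('D_(rsubmx v) phi)).
- exact: derivable_cst.
- exact: (derivable_comp_rsubmx (h := 'D_(rsubmx v) phi)).
Qed.

End Gap.

Section ItoGap.
Context {R : realType} {m r n : nat}.
Variables (phi : 'rV[R]_n -> 'rV[R]_r) (V : set 'rV[R]_n).
Hypotheses (oV : open V) (phiC2 : Ck_on 2 V phi).
Variables (X : @sde R m r) (Y : @sde R m n) (x0 : 'rV[R]_r) (y0 : 'rV[R]_n).
Hypothesis Vy0 : V y0.

Let gap (z : 'rV[R]_(r + n)) (_ : R) := lsubmx z - phi (rsubmx z).

Lemma lsubmx_delta_lshift (j : 'I_r) : lsubmx ('e_(lshift n j) : 'rV[R]_(r + n)) = 'e_j.
Proof.
by apply/rowP => i; rewrite !mxE !eqxx/= (inj_eq (@lshift_inj _ _)).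
Qed.

Lemma rsubmx_delta_lshift (j : 'I_r) : rsubmx ('e_(lshift n j) : 'rV[R]_(r + n)) = 0.
Proof. by apply/rowP => i; rewrite !mxE/= eq_rlshift. Qed.

Lemma lsubmx_delta_rshift (j : 'I_n) : lsubmx ('e_(rshift r j) : 'rV[R]_(r + n)) = 0.
Proof. by apply/rowP => i; rewrite !mxE/= eq_lrshift. Qed.

Lemma rsubmx_delta_rshift (j : 'I_n) : rsubmx ('e_(rshift r j) : 'rV[R]_(r + n)) = 'e_j.
Proof.
by apply/rowP => i; rewrite !mxE !eqxx/= (inj_eq (@rshift_inj _ _)).
Qed.

Let dphi y : V y -> differentiable phi y. Proof. by case: phiC2 => + _; apply. Qed.

Lemma sum_partial_gap (u : 'rV[R]_r) (v : 'rV[R]_n) :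
  \sum_j row_mx u v 0 j *: partial j (gap ^~ 0) (row_mx x0 y0) =
  u - v *m 'J phi y0.
Proof.
have dphi0 : differentiable phi (rsubmx (row_mx x0 y0)) by rewrite row_mxKr; exact: dphi.
rewrite big_split_ord /=; congr (_ + _).
  rewrite [RHS]row_sum_delta; apply: eq_bigr => j _.
  rewrite row_mxEl /partial derive_gap// lsubmx_delta_lshift rsubmx_delta_lshift.
  by rewrite derive0 subr0.
rewrite -deriveEjacobian; last exact: dphi.
rewrite deriveE; last exact: dphi.
rewrite [in RHS](row_sum_delta v) linear_sum -sumrN; apply: eq_bigr => j _.
rewrite row_mxEr /partial derive_gap// lsubmx_delta_rshift rsubmx_delta_rshift.
by rewrite [in RHS]linearZ /= -deriveE ?row_mxKr ?sub0r ?scalerN//; exact: dphi.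
Qed.

(** By the chain rule the noise of [phi (Y_t)] is the noise of [Y_t] pushed forward
    by the differential of [phi]. *)
Lemma ito_gap_noise al :
  ito_L1 (stacked_sde X Y) (lift ord0 al) gap (row_mx x0 y0) 0 =
  diffusion X al x0 0 - diffusion Y al y0 0 *m 'J phi y0.
Proof. by rewrite /ito_L1 liftK /= row_mxKl row_mxKr sum_partial_gap. Qed.

(** The gap is linear in the first block of variables and has no mixed terms, so
    only the second derivatives of [phi] survive. *)
Lemma partial2_gap (u v : 'rV[R]_n) (a b : 'rV[R]_r) :
  \sum_j \sum_k (row_mx a u 0 j * row_mx b v 0 k) *:
     partial j (partial k (gap ^~ 0)) (row_mx x0 y0) =
  - nabla_diff phi y0 u v.
Proof.
have dphi2 k : differentiable (partial k phi) y0.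
  by case: phiC2 => _ /(_ k) [+ _]; apply.
have d2 j k : partial j (partial k (gap ^~ 0)) (row_mx x0 y0) =
    - 'D_(rsubmx 'e_j) ('D_(rsubmx 'e_k) phi) y0.
  rewrite /partial (derive2_gap oV) ?row_mxKr//.
  case: (split_ordP k) => k' ->; last first.
    by rewrite rsubmx_delta_rshift; exact/diff_derivable/(dphi2 k').
  rewrite rsubmx_delta_lshift.
  have -> : 'D_0 phi = cst 0 by apply/funext => y; rewrite derive0.
  exact: derivable_cst.
rewrite big_split_ord /= big1 ?add0r => [|j _]; last first.
  by apply: big1 => k _; rewrite d2 rsubmx_delta_lshift derive0 oppr0 scaler0.
rewrite /nabla_diff -sumrN; apply: eq_bigr => j _.
rewrite big_split_ord /= big1 ?add0r => [|k _]; last first.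
  rewrite d2 rsubmx_delta_lshift.
  have -> : 'D_0 phi = cst 0 by apply/funext => y; rewrite derive0.
  by rewrite derive_cst oppr0 scaler0.
rewrite -sumrN; apply: eq_bigr => k _.
by rewrite d2 !row_mxEr !rsubmx_delta_rshift scalerN.
Qed.

(** Ito correction: besides the pushed-forward drift, [phi (Y_t)] has the drift
    [1/2 nabla phi (B, B)] created by the noise. *)
Lemma ito_gap_drift :
  ito_L1 (stacked_sde X Y) ord0 gap (row_mx x0 y0) 0 =
  (drift X x0 0 - 2^-1 *: \sum_al \sum_be gE al be *:
     nabla_diff phi y0 (diffusion Y al y0 0) (diffusion Y be y0 0)) -
  drift Y y0 0 *m 'J phi y0.
Proof.
rewrite /ito_L1 unlift_none /= !row_mxKl !row_mxKr derive_cst add0r.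
rewrite sum_partial_gap [RHS]addrAC -scalerN -sumrN; congr (_ + _ *: _).
under eq_bigr => j _ do rewrite exchange_big /=.
rewrite exchange_big /=; apply: eq_bigr => al _.
under eq_bigr => j _ do rewrite exchange_big /=.
rewrite exchange_big /= -sumrN; apply: eq_bigr => be _.
rewrite -scalerN -(partial2_gap _ _ (diffusion X al x0 0) (diffusion X be x0 0)).
rewrite scaler_sumr; apply: eq_bigr => j _; rewrite scaler_sumr.
by apply: eq_bigr => k _; rewrite scalerA [gE _ _ * _]mulrC.
Qed.

End ItoGap.

(** * Square-integrable random variables *)

Section SquareIntegrable.
Context {d : measure_display} {T : measurableType d} {R : realType}.
Variable P : probability T R.
Implicit Types (X Y Z : T -> R) (c : R).

(** Real-valued integrability, with the real-valued [mean] below, so that the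
    arithmetic of moments takes place in [R] rather than in [\bar R]. *)
Definition integrable_var X := P.-integrable [set: T] (EFin \o X).

Definition mean X : R := \int[P]_w X w.

Definition sq_integrable X :=
  measurable_fun [set: T] X /\ integrable_var (fun w => X w ^+ 2).

Lemma expectation_mean X : integrable_var X -> 'E_P[X]%E = (mean X)%:E.
Proof.
by move=> iX; rewrite unlock /mean /Rintegral fineK// integrable_fin_num.
Qed.

Lemma integrable_var_measurable X : integrable_var X -> measurable_fun [set: T] X.
Proof. by move=> /integrableP[/measurable_EFinP]. Qed.

Lemma le_integrable_var X Y : measurable_fun [set: T] X ->
  (forall w, `|X w| <= Y w) -> integrable_var Y -> integrable_var X.
Proof.
move=> mX XY; apply: le_integrable => //; first exact/measurable_EFinP.
by move=> w _ /=; rewrite lee_fin (le_trans (XY w))// ler_norm.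
Qed.

Lemma integrable_var_cst c : integrable_var (fun=> c).
Proof. exact: (finite_measure_integrable_cst P c measurableT). Qed.

Lemma integrable_varD X Y : integrable_var X -> integrable_var Y ->
  integrable_var (fun w => X w + Y w).
Proof. by move=> iX iY; exact: (integrableD measurableT iX iY). Qed.

Lemma integrable_varZ c X : integrable_var X -> integrable_var (fun w => c * X w).
Proof. by move=> iX; exact: (integrableZl measurableT c iX). Qed.

Lemma integrable_var_sum (J : Type) (s : seq J) (p : pred J) (X : J -> T -> R) :
  (forall j, p j -> integrable_var (X j)) ->
  integrable_var (fun w => \sum_(j <- s | p j) X j w).
Proof.
move=> iX; elim: s => [|j s IH].
  by under [X in integrable_var X]eq_fun do rewrite big_nil; exact: integrable_var_cst.
under [X in integrable_var X]eq_fun do rewrite big_cons.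
case: (boolP (p j)) => // pj; apply: integrable_varD => //; exact: iX.
Qed.

Lemma mean_cst c : mean (fun=> c) = c.
Proof.
rewrite /mean Rintegral_cst// (_ : _ [set: T] = 1%E) ?mulr1//.
exact: probability_setT.
Qed.

Lemma meanD X Y : integrable_var X -> integrable_var Y ->
  mean (fun w => X w + Y w) = mean X + mean Y.
Proof. by move=> iX iY; exact: RintegralD. Qed.

Lemma meanZ c X : integrable_var X -> mean (fun w => c * X w) = c * mean X.
Proof. by move=> iX; exact: RintegralZl. Qed.

Lemma mean_sum (J : Type) (s : seq J) (p : pred J) (X : J -> T -> R) :
  (forall j, p j -> integrable_var (X j)) ->
  mean (fun w => \sum_(j <- s | p j) X j w) = \sum_(j <- s | p j) mean (X j).
Proof.
move=> iX; elim: s => [|j s IH].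
  by rewrite big_nil; under [X in mean X]eq_fun do rewrite big_nil; exact: mean_cst.
rewrite big_cons; under [X in mean X]eq_fun do rewrite big_cons.
case: (boolP (p j)) => // pj; rewrite meanD ?IH//; [exact: iX|exact: integrable_var_sum].
Qed.

Lemma mean_ge0 X : (forall w, 0 <= X w) -> 0 <= mean X.
Proof. by move=> X0; exact: Rintegral_ge0. Qed.

Lemma le_mean X Y : integrable_var X -> integrable_var Y -> (forall w, X w <= Y w) ->
  mean X <= mean Y.
Proof. by move=> iX iY XY; exact: le_Rintegral. Qed.

Lemma sq_integrable_measurable X : sq_integrable X -> measurable_fun [set: T] X.
Proof. by case. Qed.

Lemma sq_integrable_cst c : sq_integrable (fun=> c).
Proof. by split; [exact: measurable_cst|exact: integrable_var_cst]. Qed.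

Lemma integrable_varM X Y : sq_integrable X -> sq_integrable Y ->
  integrable_var (fun w => X w * Y w).
Proof.
move=> [mX iX] [mY iY]; apply: le_integrable_var (integrable_varD iX iY).
  exact: measurable_funM.
by move=> w; rewrite ler_norml; apply/andP; split; nra.
Qed.

Lemma sq_integrable_integrable_var X : sq_integrable X -> integrable_var X.
Proof.
move=> sX; have := integrable_varM sX (sq_integrable_cst 1).
by under [X in integrable_var X]eq_fun do rewrite mulr1.
Qed.

Lemma sq_integrableD X Y : sq_integrable X -> sq_integrable Y ->
  sq_integrable (fun w => X w + Y w).
Proof.
move=> sX sY; have [mX iX] := sX; have [mY iY] := sY.
split; first exact: measurable_funD.
under [X in integrable_var X]eq_fun do rewrite sqrrD -mulr_natl.
by do ![apply: integrable_varD => //]; apply: integrable_varZ; exact: integrable_varM.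
Qed.

Lemma sq_integrableZ c X : sq_integrable X -> sq_integrable (fun w => c * X w).
Proof.
move=> [mX iX]; split; first exact: measurable_funM.
by under [X in integrable_var X]eq_fun do rewrite exprMn; exact: integrable_varZ.
Qed.

Lemma sq_integrableB X Y : sq_integrable X -> sq_integrable Y ->
  sq_integrable (fun w => X w - Y w).
Proof.
move=> sX sY; under [X in sq_integrable X]eq_fun do rewrite -mulN1r.
by apply: sq_integrableD => //; exact: sq_integrableZ.
Qed.

Lemma sq_integrable_boundedM c X Y : measurable_fun [set: T] X ->
  (forall w, `|X w| <= c) -> sq_integrable Y -> sq_integrable (fun w => X w * Y w).
Proof.
move=> mX Xc [mY iY]; split; first exact: measurable_funM.
apply: le_integrable_var (integrable_varZ (c ^+ 2) iY) => [|w].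
  by apply: measurable_funX; exact: measurable_funM.
rewrite ger0_norm ?sqr_ge0// exprMn ler_wpM2r ?sqr_ge0//.
by rewrite -real_normK ?num_real// lerXn2r ?nnegrE// (le_trans _ (Xc w)).
Qed.

(** Expand [0 <= E (X - E X)^2]. *)
Lemma sqr_mean_le X : sq_integrable X -> mean X ^+ 2 <= mean (fun w => X w ^+ 2).
Proof.
move=> sX; have [_ iX2] := sX; have iX := sq_integrable_integrable_var sX.
have : 0 <= mean (fun w => (X w - mean X) ^+ 2).
  by apply: mean_ge0 => w; exact: sqr_ge0.
have -> : (fun w => (X w - mean X) ^+ 2) =
    (fun w => X w ^+ 2 + ((- 2 * mean X) * X w + mean X ^+ 2)).
  by apply/funext => w; ring.
rewrite meanD//; last first.
  by apply: integrable_varD; [exact: integrable_varZ|exact: integrable_var_cst].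
rewrite meanD; [|exact: integrable_varZ|exact: integrable_var_cst].
by rewrite meanZ// mean_cst; nra.
Qed.

Lemma mean_sqrD_le X Y : sq_integrable X -> sq_integrable Y ->
  mean (fun w => (X w + Y w) ^+ 2) <=
  2 * (mean (fun w => X w ^+ 2) + mean (fun w => Y w ^+ 2)).
Proof.
move=> sX sY; have [_ iX] := sX; have [_ iY] := sY.
rewrite -meanD// -meanZ; last exact: integrable_varD.
apply: le_mean => [||w].
- by have [] := sq_integrableD sX sY.
- exact/integrable_varZ/integrable_varD.
- by have := sqr_ge0 (X w - Y w); nra.
Qed.

Lemma mean_ae_eq X Y : {ae P, forall w, X w = Y w} ->
  measurable_fun [set: T] X -> measurable_fun [set: T] Y -> mean X = mean Y.
Proof.
move=> XY mX mY; rewrite /mean /Rintegral; congr fine.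
apply: ae_eq_integral => //; [exact/measurable_EFinP|exact/measurable_EFinP|].
by apply: filterS XY => w /= ->.
Qed.

Lemma mean_sqr_eq0 X : sq_integrable X -> mean (fun w => X w ^+ 2) = 0 ->
  {ae P, forall w, X w = 0}.
Proof.
move=> [mX iX] X0; have mX2 := integrable_var_measurable iX.
have : (\int[P]_w `|(X w ^+ 2)%:E| = 0)%E.
  under eq_integral do rewrite gee0_abs ?lee_fin ?sqr_ge0//.
  by rewrite -[LHS]fineK ?integrable_fin_num//; congr EFin.
move=> /(ae_eq_integral_abs P measurableT (proj2 (measurable_EFinP _ _) mX2)).
apply: filterS => w /(_ I) /= [] /eqP; rewrite sqrf_eq0 => /eqP.
by [].
Qed.

(** The extended expectations tend to 0, hence are finite from some index [K]
    on; then [Z = U K - (U K - Z)] is a difference of square-integrable variables. *)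
Lemma L2_limit (U : nat -> T -> R) Z : measurable_fun [set: T] Z ->
  (forall k, sq_integrable (U k)) ->
  (fun k => 'E_P[fun w => ((U k w - Z w) ^+ 2)%R]%E) @ \oo --> 0%E ->
  sq_integrable Z /\
  (fun k => mean (fun w => (Z w - U k w) ^+ 2)) @ \oo --> (0 : R).
Proof.
move=> mZ sU cvg0.
have mUZ k : measurable_fun [set: T] (fun w => U k w - Z w).
  by apply: measurable_funB => //; have [] := sU k.
have ge0 k w : 0 <= (U k w - Z w) ^+ 2 by exact: sqr_ge0.
have /fine_cvgP[[K _ finK] cvg0'] := cvg0.
have iUZ k : (K <= k)%N -> sq_integrable (fun w => U k w - Z w).
  move=> Kk; split=> //; apply/integrableP; split.
    by apply/measurable_EFinP; exact: measurable_funX.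
  under eq_integral do rewrite /= ger0_norm//.
  by have := finK k Kk; rewrite unlock fin_numE => /andP[_]; rewrite ltey.
have sZ : sq_integrable Z.
  have -> : Z = fun w => U K w - (U K w - Z w) by apply/funext => w; ring.
  by apply: sq_integrableB => //; exact: iUZ.
split=> //.
have -> : (fun k => mean (fun w => (Z w - U k w) ^+ 2)) =
    fine \o (fun k => 'E_P[fun w => ((U k w - Z w) ^+ 2)%R]%E).
  apply/funext => k /=; rewrite expectation_mean; last first.
    by have [] := sq_integrableB (sU k) sZ.
  by congr mean; apply/funext => w; ring.
exact: cvg0'.
Qed.

(** [(E Z)^2 = (E (Z - U k))^2 <= E (Z - U k)^2] for every [k]. *)
Lemma L2_limit_mean0 (U : nat -> T -> R) Z : sq_integrable Z ->
  (forall k, sq_integrable (U k)) -> (forall k, mean (U k) = 0) ->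
  (fun k => mean (fun w => (Z w - U k w) ^+ 2)) @ \oo --> (0 : R) ->
  mean Z = 0.
Proof.
move=> sZ sU U0 cvg0; apply/eqP; rewrite -sqrf_eq0 eq_le sqr_ge0 andbT.
apply: (ler_cvg_to (cvg_cst (mean Z ^+ 2)) cvg0); apply: nearW => k.
have -> : mean Z = mean (fun w => Z w - U k w).
  have -> : (fun w => Z w - U k w) = fun w => Z w + (-1) * U k w.
    by apply/funext => w; ring.
  have iZ := sq_integrable_integrable_var sZ.
  have iU := sq_integrable_integrable_var (sU k).
  by rewrite meanD ?meanZ ?U0 ?mulr0 ?addr0//; exact: integrable_varZ.
exact/sqr_mean_le/sq_integrableB.
Qed.

Lemma L2_limit_unique (U : nat -> T -> R) Y Z : sq_integrable Y -> sq_integrable Z ->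
  (forall k, sq_integrable (U k)) ->
  (fun k => mean (fun w => (Y w - U k w) ^+ 2)) @ \oo --> (0 : R) ->
  (fun k => mean (fun w => (Z w - U k w) ^+ 2)) @ \oo --> (0 : R) ->
  {ae P, forall w, Y w = Z w}.
Proof.
move=> sY sZ sU cY cZ; suff : {ae P, forall w, Y w - Z w = 0}.
  by apply: filterS => w /eqP; rewrite subr_eq0 => /eqP.
apply: mean_sqr_eq0; first exact: sq_integrableB.
apply/eqP; rewrite eq_le mean_ge0 ?andbT//; last by move=> w; exact: sqr_ge0.
have c0 : (fun k => 2 * (mean (fun w => (Y w - U k w) ^+ 2) +
    mean (fun w => (Z w - U k w) ^+ 2))) @ \oo --> (0 : R).
  rewrite -(mulr0 2) -[X in 2 * X](addr0 0).
  by apply: cvgM; [exact: cvg_cst|exact: cvgD].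
apply: (ler_cvg_to (cvg_cst _) c0); apply: nearW => k.
have -> : (fun w => (Y w - Z w) ^+ 2) =
    fun w => ((Y w - U k w) + (-1) * (Z w - U k w)) ^+ 2.
  by apply/funext => w; ring.
have sYU := sq_integrableB sY (sU k); have sZU := sq_integrableB sZ (sU k).
apply: (le_trans (mean_sqrD_le sYU (sq_integrableZ (-1) sZU))).
under [X in 2 * (_ + mean X)]eq_fun do rewrite mulN1r sqrrN.
by [].
Qed.

End SquareIntegrable.

(** * Products of independent variables *)

Section IndependentProduct.
Context {d : measure_display} {T : measurableType d} {R : realType}.
Variable P : probability T R.
Local Open Scope ereal_scope.

Definition independent_var (X Y : T -> R) := forall A B : set R,
  measurable A -> measurable B ->
  P (X @^-1` A `&` Y @^-1` B) = P (X @^-1` A) * P (Y @^-1` B).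

Section RandomVariables.
Variables X Y : {mfun T >-> R}.
Hypothesis XY : independent_var X Y.

Let pair w := (X w, Y w).

Let measurable_pair : measurable_fun [set: T] pair.
Proof. exact: measurable_fun_pair. Qed.

HB.instance Definition _ := isMeasurableFun.Build _ _ _ _ pair measurable_pair.

Let joint_law (A : set (R * R)) : measurable A ->
  (distribution P X \x distribution P Y) A = distribution P pair A.
Proof.
apply: product_measure_unique => B C mB mC.
by rewrite /distribution /pushforward /= -XY//.
Qed.

(** The product rule on rectangles identifies the law of the pair with the product
    of the two laws, and the integral of [x * y] against the latter factors by
    Fubini. *)
Lemma mfun_independent_meanM : integrable_var P X -> integrable_var P Y ->
  integrable_var P (fun w => X w * Y w)%R /\
  (mean P (fun w => X w * Y w) = mean P X * mean P Y)%R.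
Proof.
move=> iX iY.
have mprod : measurable_fun setT (fun z : R * R => (z.1 * z.2)%:E).
  by apply/measurable_EFinP; exact: measurable_funM.
have mnorm : measurable_fun [set: R] (fun x : R => `|x|%:E).
  by apply/measurable_EFinP; exact: normr_measurable.
have iY' : (distribution P Y).-integrable setT (@EFin R).
  exact: integrable_pushforward.
have iX' : (distribution P X).-integrable setT (@EFin R).
  exact: integrable_pushforward.
have iprod : (distribution P X \x distribution P Y).-integrable setT
    (fun z => (z.1 * z.2)%:E).
  apply/integrable12ltyP => //=.
  under eq_integral => x _.
    under eq_integral do rewrite normrM EFinM.
    rewrite ge0_integralZl//.
    over.
  have [_ yX] := integrableP _ _ _ iX'; have [_ yY] := integrableP _ _ _ iY'.
  rewrite /= ge0_integralZr//; last exact: integral_ge0.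
  apply: lte_mul_pinfty => //; first exact: integral_ge0.
  by rewrite ge0_fin_numE//; exact: integral_ge0.
have isum : integrable_var P (fun w => X w * Y w)%R.
  apply/integrableP; split.
    by apply/measurable_EFinP; exact: measurable_funM.
  have [_] := integrableP _ _ _ iprod.
  rewrite (eq_measure_integral (distribution P pair)); last first.
    by move=> A mA _; exact: joint_law.
  by rewrite ge0_integral_pushforward//; exact: measurableT_comp.
split=> //; apply: EFin_inj; rewrite EFinM /mean /Rintegral.
rewrite !fineK ?integrable_fin_num//.
transitivity (\int[distribution P pair]_z (z.1 * z.2)%:E).
  by rewrite integral_pushforward.
rewrite (eq_measure_integral (distribution P X \x distribution P Y)); last first.
  by move=> A mA _; exact/esym/joint_law.
rewrite -integral12_prod_meas1// /fubini_F /=.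
under eq_integral => x _.
  under eq_integral do rewrite EFinM.
  rewrite integralZl//.
  over.
have fY : \int[distribution P Y]_y y%:E \is a fin_num by rewrite integrable_fin_num.
rewrite -(fineK fY) integralZr// fineK//.
by rewrite !integral_pushforward.
Qed.

End RandomVariables.

End IndependentProduct.

Lemma independent_meanM (d : measure_display) (T : measurableType d) (R : realType)
    (P : probability T R) (X Y : T -> R) :
  independent_var P X Y -> integrable_var P X -> integrable_var P Y ->
  integrable_var P (fun w => X w * Y w) /\
  mean P (fun w => X w * Y w) = mean P X * mean P Y.
Proof.
move=> XY iX iY.
pose X' := mfun_Sub (mem_set (integrable_var_measurable iX)) : {mfun T >-> R}.
pose Y' := mfun_Sub (mem_set (integrable_var_measurable iY)) : {mfun T >-> R}.
exact: (@mfun_independent_meanM _ _ _ P X' Y').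
Qed.

(** * Centred normal variables *)

Section Normal.
Context {d : measure_display} {T : measurableType d} {R : realType}.
Variable P : probability T R.
Local Notation mu := (@lebesgue_measure R).

Lemma ge0_integral_oppr (f : R -> \bar R) : measurable_fun [set: R] f ->
  (forall x, 0 <= f x)%E -> (\int[mu]_x f (- x)%R = \int[mu]_x f x)%E.
Proof.
move=> mf f0.
transitivity (\int[pushforward mu (-%R : _ -> measurableTypeR R)]_x f x)%E.
  by rewrite ge0_integral_pushforward.
by apply: eq_measure_integral => //= A mA _; exact: lebesgue_measureN.
Qed.

Variables (X : T -> R) (s : R).
Hypotheses (mX : measurable_fun [set: T] X) (s0 : 0 < s).
Hypothesis law : forall C, measurable C -> P (X @^-1` C) = normal_prob 0 s C.

(** The density [normal_pdf] agrees almost everywhere with the Radon-Nikodym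
    derivative of the normal law, for which the change of variables holds. *)
Lemma ge0_integral_normal (h : R -> R) : measurable_fun [set: R] h ->
  (forall x, 0 <= h x) ->
  (\int[P]_w (h (X w))%:E = \int[mu]_x (h x * normal_pdf 0 s x)%:E)%E.
Proof.
move=> mh h0.
have dom := normal_prob_dominates 0 s.
have mh' : measurable_fun [set: R] (EFin \o h) by exact/measurable_EFinP.
transitivity (\int[normal_prob 0 s]_x (h x)%:E)%E.
  have mXb : measurable_fun [set: T] (X : T -> measurableTypeR R) := mX.
  pose X' : {mfun T >-> measurableTypeR R} :=
    @mfun_Sub _ _ T (measurableTypeR R) X (mem_set mXb).
  transitivity (\int[distribution P X']_x (h x)%:E)%E.
    by rewrite ge0_integral_distribution.
  apply: (eq_measure_integral (normal_prob 0 s)).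
  by move=> C mC _; exact: law.
rewrite -(Radon_Nikodym_SigmaFinite.change_of_variables dom)//.
apply: ae_eq_integral => //.
- apply: emeasurable_funM => //.
  exact: measurable_int (Radon_Nikodym_SigmaFinite.f_integrable dom).
- apply/measurable_EFinP/measurable_funM => //; exact: measurable_normal_pdf.
apply: filterS (_ : ae_eq mu setT (Radon_Nikodym_SigmaFinite.f (normal_prob 0 s) mu)
  (fun x => (normal_pdf 0 s x)%:E)) => [x /= + _ |].
  by move=> -> //; rewrite EFinM.
apply: integral_ae_eq => //.
- exact: (Radon_Nikodym_SigmaFinite.f_integrable dom).
- by apply/measurable_EFinP; exact: measurable_normal_pdf.
- by move=> E _ mE; rewrite -(Radon_Nikodym_SigmaFinite.f_integral dom).
Qed.

(** With [u = x^2 / s^2] this is [u * expR (- u / 2) <= 4 * expR (- u / 8)], a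
    consequence of [1 + y <= expR y] at [y = 3 u / 8]; the factor 8 is 4 times the
    ratio 2 of the peaks of the two densities. *)
Lemma sqr_normal_pdf_le (x : R) :
  x ^+ 2 * normal_pdf 0 s x <= 8 * s ^+ 2 * normal_pdf 0 (2 * s) x.
Proof.
rewrite !normal_pdfE ?mulf_neq0 ?pnatr_eq0 ?gt_eqF// /normal_fun subr0.
have -> : normal_peak (2 * s) = normal_peak s / 2.
  rewrite /normal_peak exprMn -mulrA -mulrnAr sqrtrM ?exprn_ge0//.
  by rewrite sqrtr_sqr ger0_norm// invfM mulrC.
set u := x ^+ 2 / s ^+ 2; have s2 : 0 < s ^+ 2 by rewrite exprn_gt0.
have u0 : 0 <= u by rewrite divr_ge0 ?sqr_ge0.
have xu : x ^+ 2 = u * s ^+ 2 by rewrite divfK// gt_eqF.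
have -> : - x ^+ 2 / (s ^+ 2 *+ 2) = - (u / 8) - 3 / 8 * u.
  by rewrite xu -mulr_natr; field; rewrite gt_eqF.
have -> : - x ^+ 2 / ((2 * s) ^+ 2 *+ 2) = - (u / 8).
  by rewrite xu -mulr_natr; field; rewrite gt_eqF.
rewrite expRD xu.
have ule : u * expR (- (3 / 8 * u)) <= 4.
  rewrite expRN ler_pdivrMr ?expR_gt0//.
  by have := expR_ge1Dx (3 / 8 * u); lra.
have p0 : 0 < s ^+ 2 * normal_peak s * expR (- (u / 8)).
  by rewrite !mulr_gt0 ?expR_gt0 ?normal_peak_gt0 ?gt_eqF.
have := ler_wpM2l (ltW p0) ule; congr (_ <= _).
  by ring.
by field.
Qed.

(** Integrate the pointwise bound against the total mass 1 of the wider normal law. *)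
Lemma normal_second_moment : (\int[P]_w (X w ^+ 2)%:E <= (8 * s ^+ 2)%:E)%E.
Proof.
rewrite (ge0_integral_normal (h := fun x => x ^+ 2))//; last first.
  by move=> x; exact: sqr_ge0.
apply: (@le_trans _ _ (\int[mu]_x ((8 * s ^+ 2)%:E * (normal_pdf 0 (2 * s) x)%:E))%E).
  apply: ge0_le_integral => //.
  - by move=> x _; rewrite lee_fin mulr_ge0 ?sqr_ge0 ?normal_pdf_ge0.
  - by apply/measurable_EFinP/measurable_funM => //; exact: measurable_normal_pdf.
  - apply/measurable_EFinP/measurable_funM => //; exact: measurable_normal_pdf.
  - by move=> x _; rewrite -EFinM lee_fin sqr_normal_pdf_le.
rewrite integralZl//; last exact: integrable_normal_pdf.
by rewrite integral_normal_pdf mule1.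
Qed.

Lemma normal_sq_integrable : sq_integrable P X.
Proof.
split=> //; apply/integrableP; split.
  by apply/measurable_EFinP; exact: measurable_funX.
under eq_integral do rewrite /= ger0_norm ?sqr_ge0//.
exact: le_lt_trans normal_second_moment (ltry _).
Qed.

Lemma normal_variance_le : mean P (fun w => X w ^+ 2) <= 8 * s ^+ 2.
Proof.
have [_ iX2] := normal_sq_integrable.
rewrite -lee_fin -expectation_mean// unlock; exact: normal_second_moment.
Qed.

(** The density is even, so the positive and negative parts of [X] have the same
    mean. *)
Lemma normal_mean : mean P X = 0.
Proof.
have iX := sq_integrable_integrable_var normal_sq_integrable.
(* The positive part; [h \o -%R] is the negative part. *)
pose h (x : R) := Num.max x 0.
have mh : measurable_fun [set: R] h by exact: measurable_maxr.
have h0 x : 0 <= h x by rewrite le_max lexx orbT.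
have mhN : measurable_fun [set: R] (h \o -%R) by exact: measurableT_comp.
have ihX (g : R -> R) : measurable_fun [set: R] g -> (forall x, `|g x| <= `|x|) ->
    integrable_var P (g \o X).
  move=> mg gx; apply: (le_integrable_var (Y := fun w => `|X w|)).
  - exact: measurableT_comp.
  - by move=> w; exact: gx.
  - exact: integrable_norm.
have hx x : `|h x| <= `|x| by rewrite /h; case: (leP x 0); rewrite ?normr0.
have -> : X = fun w => (h \o X) w + (-1) * ((h \o -%R) \o X) w.
  apply/funext => w; rewrite /h /=; case: (leP (X w) 0) => X0.
    by rewrite max_l ?oppr_ge0//; ring.
  by rewrite max_r ?oppr_le0 1?ltW//; ring.
have i1 : integrable_var P (h \o X) by exact: ihX.
have i2 : integrable_var P ((h \o -%R) \o X).
  by apply: ihX => // x /=; rewrite (le_trans (hx _))// normrN.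
rewrite meanD//; last exact: integrable_varZ.
rewrite meanZ// mulN1r; apply/eqP; rewrite subr_eq0; apply/eqP.
apply: EFin_inj; rewrite -!expectation_mean// !unlock /=.
rewrite (ge0_integral_normal mh h0) (ge0_integral_normal mhN (fun x => h0 (- x))).
rewrite -[LHS]ge0_integral_oppr.
- apply: eq_integral => x _; congr (_ * _)%:E.
  by rewrite !normal_pdfE ?gt_eqF// /normal_fun !subr0 sqrrN.
- by apply/measurable_EFinP/measurable_funM => //; exact: measurable_normal_pdf.
- by move=> x; rewrite lee_fin mulr_ge0 ?normal_pdf_ge0.
Qed.

(** Otherwise [X] would vanish almost surely, whereas a law with a density has no
    atom. *)
Lemma normal_variance_gt0 : 0 < mean P (fun w => X w ^+ 2).
Proof.
rewrite lt_neqAle mean_ge0 ?andbT; last by move=> w; exact: sqr_ge0.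
apply/eqP => /esym /(mean_sqr_eq0 normal_sq_integrable) [N [mN PN XN]].
have : (P [set: T] <= P (X @^-1` [set 0%R]) + P N)%E.
  rewrite (le_trans _ (measureU2 _ _ _))//; last first.
    by rewrite -[X in measurable X]setTI; exact: mX.
  rewrite le_measure ?inE//.
    by apply: measurableU => //; rewrite -[X in measurable X]setTI; exact: mX.
  by move=> w _; have [X0|X0] := pselect (X w = 0); [left|right; exact: XN].
rewrite PN adde0 law// /normal_prob integral_set1 (_ : P _ = 1%E) ?lee_fin ?ler10//.
exact: probability_setT.
Qed.

End Normal.

(** * Adapted variables *)

Section Adapted.
Context {d : measure_display} {T : measurableType d} {R : realType}.
Implicit Types (G : set (set T)) (X Y : T -> R).

Lemma sigma_varP G X :
  sigma_var X `<=` G <-> forall C, measurable C -> G (X @^-1` C).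
Proof.
split=> [XG C mC|XG _ [C mC <-]]; last by rewrite setTI; exact: XG.
by apply: XG; exists C => //; rewrite setTI.
Qed.

(** This makes the closure properties of measurable functions available for
    adapted variables. *)
Lemma adaptedP G X : sigma_algebra [set: T] G ->
  sigma_var X `<=` G <->
  measurable_fun ([set: T] : set (g_sigma_algebraType G)) X.
Proof.
move=> /sigma_algebra_id GE; rewrite sigma_varP; split=> [XG _ C mC|mX C mC].
  by rewrite setTI; apply: sub_sigma_algebra; exact: XG.
by have : <<s G >> (X @^-1` C); [rewrite -[X in <<s G >> X]setTI; exact: mX|rewrite GE].
Qed.

Lemma adapted_measurable G X : G `<=` measurable -> sigma_var X `<=` G ->
  measurable_fun [set: T] X.
Proof. by move=> Gm /sigma_varP XG _ C mC; rewrite setTI; apply/Gm/XG. Qed.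

Lemma adapted_le G H X : G `<=` H -> sigma_var X `<=` G -> sigma_var X `<=` H.
Proof. by move=> GH XG; exact: (subset_trans XG GH). Qed.

Variable G : set (set T).
Hypothesis sG : sigma_algebra [set: T] G.

Lemma adapted_cst (c : R) : sigma_var (fun _ : T => c) `<=` G.
Proof. by apply/(adaptedP _ sG); exact: measurable_cst. Qed.

Lemma adaptedD X Y : sigma_var X `<=` G -> sigma_var Y `<=` G ->
  sigma_var (fun w => X w + Y w) `<=` G.
Proof.
move=> /(adaptedP _ sG) mX /(adaptedP _ sG) mY; apply/(adaptedP _ sG).
exact: measurable_funD.
Qed.

Lemma adaptedB X Y : sigma_var X `<=` G -> sigma_var Y `<=` G ->
  sigma_var (fun w => X w - Y w) `<=` G.
Proof.
move=> /(adaptedP _ sG) mX /(adaptedP _ sG) mY; apply/(adaptedP _ sG).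
exact: measurable_funB.
Qed.

Lemma adaptedM X Y : sigma_var X `<=` G -> sigma_var Y `<=` G ->
  sigma_var (fun w => X w * Y w) `<=` G.
Proof.
move=> /(adaptedP _ sG) mX /(adaptedP _ sG) mY; apply/(adaptedP _ sG).
exact: measurable_funM.
Qed.

End Adapted.

(** * Stochastic integrals of step processes *)

Section SimpleIntegral.
Context {d : measure_display} {T : measurableType d} {R : realType}.
Variables (P : probability T R) (F : R -> set (set T)) (B : R -> T -> R).

(** A single Brownian motion relative to the filtration [F], with the independence
    of future increments from the past stated for random variables, the form used
    in moment computations. *)
Definition brownian_wrt : Prop :=
  [/\ filtration F,
      forall t, 0 <= t -> sigma_var (B t) `<=` F t,
      forall s t, 0 <= s -> s < t -> forall C : set R, measurable C ->
        P ((B t \- B s) @^-1` C) = normal_prob 0 (Num.sqrt (t - s)) C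
    & forall s t, 0 <= s -> s <= t -> forall X : T -> R,
        sigma_var X `<=` F s -> independent_var P X (B t \- B s)].

Hypothesis hB : brownian_wrt.

Let sF t : 0 <= t -> sigma_algebra [set: T] (F t).
Proof. by case: hB => -[+ _ _] _ _ _; exact. Qed.

Let Fm t : 0 <= t -> F t `<=` measurable.
Proof. by case: hB => -[_ + _] _ _ _; exact. Qed.

Let F_le s t : 0 <= s -> s <= t -> F s `<=` F t.
Proof. by case: hB => -[_ _ +] _ _ _; exact. Qed.

Lemma brownian_measurable t : 0 <= t -> measurable_fun [set: T] (B t).
Proof.
by move=> t0; case: hB => _ /(_ t t0) Bt _ _; exact: adapted_measurable (Fm t0) Bt.
Qed.

Lemma brownian_increment s t : 0 <= s -> s <= t ->
  [/\ sq_integrable P (B t \- B s), mean P (B t \- B s) = 0 &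
      mean P (fun w => (B t \- B s) w ^+ 2) <= 8 * (t - s)].
Proof.
move=> s0; rewrite le_eqVlt => /predU1P[<-|st].
  have -> : B s \- B s = fun=> 0 by apply/funext => w; rewrite /= subrr.
  split; [exact: sq_integrable_cst|exact: mean_cst|].
  by rewrite mean_cst subrr mulr0 expr0n.
have ts : 0 < t - s by rewrite subr_gt0.
have sq0 : 0 < Num.sqrt (t - s) by rewrite sqrtr_gt0.
have mD : measurable_fun [set: T] (B t \- B s).
  by apply: measurable_funB; apply: brownian_measurable; rewrite // (le_trans s0)// ltW.
have law C : measurable C ->
    P ((B t \- B s) @^-1` C) = normal_prob 0 (Num.sqrt (t - s)) C.
  by case: hB => _ _ + _; apply.
split; [exact: normal_sq_integrable law|exact: normal_mean law|].
by rewrite -[in leRHS](sqr_sqrtr (ltW ts)); exact: normal_variance_le law.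
Qed.

Section Martingale.
Variables (N : nat) (u : nat -> R) (c : nat -> T -> R).
Hypotheses (u0 : 0 <= u 0%N) (u_le : forall i, (i < N)%N -> u i <= u i.+1).
Hypothesis c_adapted : forall i, (i < N)%N -> sigma_var (c i) `<=` F (u i).
Hypothesis c_bounded :
  forall i, (i < N)%N -> exists K : R, forall w, `|c i w| <= K.

Let M k w := \sum_(i < k) c i w * (B (u i.+1) w - B (u i) w).

Lemma node_ge0 k : (k <= N)%N -> 0 <= u k.
Proof.
by elim: k => // k IH kN; rewrite (le_trans (IH (ltnW kN)))// u_le.
Qed.

Lemma coef_sq_integrable i : (i < N)%N -> sq_integrable P (c i).
Proof.
move=> iN; have [K cK] := c_bounded iN.
have mc := adapted_measurable (Fm (node_ge0 (ltnW iN))) (c_adapted iN).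
have := sq_integrable_boundedM mc cK (sq_integrable_cst P 1).
by under [X in sq_integrable _ X]eq_fun do rewrite mulr1.
Qed.

(** Adding one step to the sum [M k] adds [c k * D] with [D] centred and
    independent of the past. Hence the mean stays 0, the cross term
    [2 * (c k * M k) * D] of the square has mean 0, and [c k ^+ 2 * D ^+ 2] has mean
    at most [8 * E (c k ^+ 2) * (u k.+1 - u k)]. Being adapted is carried along in
    the induction because the cross term needs it for [M k]. *)
Lemma simple_integral_moments k : (k <= N)%N ->
  [/\ sigma_var (M k) `<=` F (u k), sq_integrable P (M k), mean P (M k) = 0 &
      mean P (fun w => M k w ^+ 2) <=
      8 * \sum_(i < k) mean P (fun w => c i w ^+ 2) * (u i.+1 - u i)].
Proof.
elim: k => [_|k IH kN].
  have -> : M 0%N = fun=> 0 by apply/funext => w; rewrite /M big_ord0.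
  split; [exact: (adapted_cst (sF u0))|exact: sq_integrable_cst|exact: mean_cst|].
  by rewrite mean_cst big_ord0 expr0n mulr0.
have [adM sM M0 M2] := IH (ltnW kN).
have k0 := node_ge0 (ltnW kN); have kS := u_le kN; have kS0 := node_ge0 kN.
have [sD D0 D2] := brownian_increment k0 kS.
set D := B (u k.+1) \- B (u k) in sD D0 D2.
have MS : M k.+1 = fun w => M k w + c k w * D w.
  by apply/funext => w; rewrite /M big_ord_recr.
have [K cK] := c_bounded kN; have sc := coef_sq_integrable kN.
have mc := sq_integrable_measurable sc.
have adD : sigma_var D `<=` F (u k.+1).
  case: hB => _ adB _ _; apply: adaptedB; [exact: sF|exact: adB|].
  by apply: adapted_le (F_le k0 kS) _; exact: adB.
have scD : sq_integrable P (fun w => c k w * D w) by exact: sq_integrable_boundedM cK sD.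
have indep X : sigma_var X `<=` F (u k) -> independent_var P X D.
  by case: hB => _ _ _; apply.
have [icD cD0] : integrable_var P (fun w => c k w * D w) /\
    mean P (fun w => c k w * D w) = 0.
  have [icD ->] := independent_meanM (indep _ (c_adapted kN))
    (sq_integrable_integrable_var sc) (sq_integrable_integrable_var sD).
  by rewrite D0 mulr0.
have sMc : sq_integrable P (fun w => c k w * M k w).
  exact: sq_integrable_boundedM cK sM.
have [iMcD McD0] : integrable_var P (fun w => (c k w * M k w) * D w) /\
    mean P (fun w => (c k w * M k w) * D w) = 0.
  have adMc := adaptedM (sF k0) (c_adapted kN) adM.
  have [icD' ->] := independent_meanM (indep _ adMc)
    (sq_integrable_integrable_var sMc) (sq_integrable_integrable_var sD).
  by rewrite D0 mulr0.
have [icD2 cD2] : integrable_var P (fun w => c k w ^+ 2 * D w ^+ 2) /\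
    mean P (fun w => c k w ^+ 2 * D w ^+ 2) =
    mean P (fun w => c k w ^+ 2) * mean P (fun w => D w ^+ 2).
  apply: independent_meanM; [|by case: sc|by case: sD].
  move=> C1 C2 mC1 mC2.
  pose sqr := fun x : R => x ^+ 2.
  have msqr : measurable_fun [set: R] sqr by exact: measurable_funX.
  apply: (indep _ (c_adapted kN) (sqr @^-1` C1) (sqr @^-1` C2)).
    by rewrite -[X in measurable X]setTI; exact: msqr.
  by rewrite -[X in measurable X]setTI; exact: msqr.
rewrite MS; split.
- apply: adaptedD; [exact: sF|exact: adapted_le (F_le k0 kS) adM|].
  apply: adaptedM; [exact: sF|exact: adapted_le (F_le k0 kS) (c_adapted kN)|exact: adD].
- exact: sq_integrableD.
- rewrite meanD//; last exact: sq_integrable_integrable_var.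
  by rewrite M0 cD0 addr0.
- have -> : (fun w => (M k w + c k w * D w) ^+ 2) =
      fun w => M k w ^+ 2 + (2 * ((c k w * M k w) * D w) + c k w ^+ 2 * D w ^+ 2).
    by apply/funext => w; ring.
  rewrite meanD; [|by case: sM|by apply: integrable_varD => //; exact: integrable_varZ].
  rewrite meanD//; last exact: integrable_varZ.
  rewrite meanZ// McD0 mulr0 add0r cD2 big_ord_recr mulrDr lerD//= mulrCA.
  by apply: ler_wpM2l => //; apply: mean_ge0 => w; exact: sqr_ge0.
Qed.

End Martingale.

End SimpleIntegral.

Section StepFunctions.
Context {R : realType}.
Variables (N : nat) (u : nat -> R).
Hypothesis u_le : forall i, (i < N)%N -> u i <= u i.+1.
Local Notation step i s := (\1_(`](u i), (u i.+1)]) s : R).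

Lemma node_le i j : (i <= j <= N)%N -> u i <= u j.
Proof.
case/andP; elim: j => [|j IH]; first by rewrite leqn0 => /eqP->.
rewrite leq_eqVlt ltnS => /predU1P[->//|ij jN].
by rewrite (le_trans (IH ij (ltnW jN)))// u_le.
Qed.

Lemma step_eq0 i k s : (i < k <= N)%N -> u k < s -> step i s = 0.
Proof.
move=> ikN us; rewrite indicE memNset//= in_itv/= => /andP[_].
by rewrite leNgt (le_lt_trans (node_le ikN)).
Qed.

Lemma sum_step s : \sum_(i < N) step i s = \1_(`](u 0%N), (u N)]) s.
Proof.
suff H k : (k <= N)%N -> \sum_(i < k) step i s = \1_(`](u 0%N), (u k)]) s by exact: H.
elim: k => [_|k IH kN]; first by rewrite big_ord0 set_itvoc0 indic0.
rewrite big_ord_recr /= (IH (ltnW kN)) !indicE.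
have u0k : u 0%N <= u k by apply: node_le; rewrite /= ltnW.
have ukS := u_le kN.
rewrite !mem_setE !in_itv /=.
have [su0|su0] := leP s (u 0%N).
  by rewrite [u k < s]ltNge (le_trans su0 u0k) addr0.
have [suk|suk] := leP s (u k); first by rewrite (le_trans suk ukS) addr0.
by rewrite add0r.
Qed.

(** The steps are disjoint, so the cross terms vanish. *)
Lemma sqr_sum_step (a : nat -> R) s :
  (\sum_(i < N) a i * step i s) ^+ 2 = \sum_(i < N) a i ^+ 2 * step i s.
Proof.
suff H k : (k <= N)%N -> (\sum_(i < k) a i * step i s) ^+ 2 =
    \sum_(i < k) a i ^+ 2 * step i s by exact: H.
elim: k => [_|k IH kN]; first by rewrite !big_ord0 expr0n.
rewrite !big_ord_recr /= -(IH (ltnW kN)).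
have [sk|sk] := boolP (s \in `](u k), (u k.+1)]); last first.
  by rewrite indicE mem_setE (negbTE sk) !mulr0 !addr0.
rewrite big1 ?add0r => [|i _]; last first.
  rewrite (@step_eq0 i k) ?mulr0//; first by rewrite ltn_ord ltnW.
  by move: sk; rewrite in_itv => /andP[].
by rewrite expr0n add0r indicE mem_setE sk !mulr1.
Qed.

(** Up to the null set [{u 0}], the constant [c] is a step function on the same
    nodes. *)
Lemma integral_sqr_sum_step (a : nat -> R) (c : R) :
  (\int[lebesgue_measure]_(s in `[u 0%N, u N])
     ((\sum_(i < N) a i * step i s - c) ^+ 2)%:E =
   (\sum_(i < N) (a i - c) ^+ 2 * (u i.+1 - u i))%:E)%E.
Proof.
have mstep i : measurable_fun [set: R] (fun s => step i s) by exact: measurable_indic.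
have msum (D : set R) (b : nat -> R) :
    measurable_fun D (fun s => \sum_(i < N) b i * step i s).
  by apply: measurable_sum => i; apply: measurable_funM => //; exact: measurable_funTS.
rewrite -integral_itv_obnd_cbnd; last first.
  by apply/measurable_EFinP/measurable_funX/measurable_funB.
transitivity (\int[lebesgue_measure]_(s in `]u 0%N, u N])
    (\sum_(i < N) ((a i - c) ^+ 2 * step i s)%:E))%E.
  apply: eq_integral => s; rewrite inE /= => sI.
  have cE : c = \sum_(i < N) c * step i s.
    by rewrite -mulr_sumr sum_step indicE mem_set ?mulr1.
  rewrite sumEFin {1}cE -sumrB; under eq_bigr do rewrite -mulrBl.
  by rewrite (sqr_sum_step (fun i => a i - c)).
rewrite ge0_integral_sum//; last 2 first.
- by move=> i; apply/measurable_EFinP/measurable_funM => //; exact: measurable_funTS.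
- by move=> i s _; rewrite lee_fin mulr_ge0 ?sqr_ge0// indicE.
rewrite -sumEFin; apply: eq_bigr => i _.
under eq_integral do rewrite EFinM.
rewrite ge0_integralZl//; last 2 first.
- exact/measurable_EFinP/measurable_funTS.
- by rewrite lee_fin sqr_ge0.
rewrite integral_indic// [X in (_ * X)%E](_ : _ = (u i.+1 - u i)%:E)//.
rewrite setIidl; last first.
  move=> s /=; rewrite !in_itv/= => /andP[us su]; apply/andP; split.
    by rewrite (le_lt_trans _ us)// node_le//= ltnW.
  by rewrite (le_trans su)// node_le// ltn_ord leqnn.
rewrite /= lebesgue_measure_itv/= lte_fin; case: ltP => // ui.
by have := u_le (ltn_ord i); move=> /(conj ui)/andP/le_anti ->; rewrite subrr.
Qed.

End StepFunctions.

(** * Ito integrals *)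

Section ItoIntegral.
Context {d : measure_display} {T : measurableType d} {R : realType}.
Variables (P : probability T R) (F : R -> set (set T)) (B : R -> T -> R).
Hypothesis hB : brownian_wrt P F B.
Variables (t1 t2 : R).
Hypotheses (t10 : 0 <= t1) (t12 : t1 <= t2).

Lemma simple_integral_mean (S : simple_process F t1 t2) :
  sq_integrable P (simple_integral S B) /\ mean P (simple_integral S B) = 0.
Proof.
have u0 : 0 <= sp_node S 0 by rewrite sp_node_first.
have [_ sM M0 _] := simple_integral_moments hB u0 (@sp_node_le _ _ _ _ _ _ S)
  (@sp_coef_meas _ _ _ _ _ _ S) (@sp_coef_bnd _ _ _ _ _ _ S) (leqnn _).
by [].
Qed.

(** Along the nodes of [S] the increment [B t2 - B t1] telescopes into the integral
    of the step process 1, so the difference is the integral of the step process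
    with coefficients [sp_coef S i - 1]. *)
Lemma simple_integral_sub (S : simple_process F t1 t2) :
  ((mean P (fun w => (simple_integral S B w - (B t2 w - B t1 w)) ^+ 2)%R)%:E <=
  8%:E * mean_square P t1 t2 (fun s w => simple_value S s w - 1)%R)%E.
Proof.
have u0 : 0 <= sp_node S 0 by rewrite sp_node_first.
pose N := sp_size S; pose u := sp_node S; pose c i w := sp_coef S i w - 1.
have u0E : u 0%N = t1 by exact: sp_node_first.
have uNE : u N = t2 by exact: sp_node_last.
have u_le i : (i < N)%N -> u i <= u i.+1 by exact: sp_node_le.
have c_adapted i : (i < N)%N -> sigma_var (c i) `<=` F (u i).
  move=> iN; have sF : sigma_algebra [set: T] (F (u i)).
    by case: hB => -[+ _ _] _ _ _; apply; exact: (node_ge0 u0 u_le (ltnW iN)).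
  by apply: adaptedB => //; [exact: sp_coef_meas|exact: adapted_cst].
have c_bounded i : (i < N)%N -> exists K : R, forall w, `|c i w| <= K.
  move=> iN; have [K cK] := sp_coef_bnd iN; exists (K + 1) => w.
  by rewrite (le_trans (ler_normB _ _))// normr1 lerD2r.
have [_ _ _] := simple_integral_moments hB u0 u_le c_adapted c_bounded (leqnn N).
have sc i : (i < N)%N -> integrable_var P (fun w => c i w ^+ 2).
  by move=> iN; have [] := coef_sq_integrable hB u0 u_le c_adapted c_bounded iN.
have -> : (fun w => (\sum_(i < N) c i w * (B (u i.+1) w - B (u i) w)) ^+ 2) =
    fun w => (simple_integral S B w - (B t2 w - B t1 w)) ^+ 2.
  apply/funext => w; congr (_ ^+ 2); under eq_bigr do rewrite mulrBl mul1r.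
  rewrite sumrB; congr (_ - _).
  rewrite -(big_mkord xpredT (fun i => B (u i.+1) w - B (u i) w)) telescope_sumr//.
  by rewrite u0E uNE.
rewrite -lee_fin EFinM => /le_trans; apply; rewrite le_eqVlt; apply/orP; left.
apply/eqP; congr (_ * _)%E.
under eq_bigr => i _ do rewrite mulrC -(meanZ _ (sc i (ltn_ord i))).
rewrite -mean_sum => [|i _]; last exact/integrable_varZ/sc.
rewrite -expectation_mean; last first.
  by apply: integrable_var_sum => i _; exact/integrable_varZ/sc.
rewrite unlock /mean_square; apply: eq_integral => w _.
have := integral_sqr_sum_step u_le (fun i => sp_coef S i w) 1.
rewrite u0E uNE => ->.
by congr EFin; apply: eq_bigr => i _; rewrite mulrC.
Qed.

(** Integrals of step processes are centred, and this passes to mean-square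
    limits. *)
Lemma ito_integral_mean (H : R -> T -> R) (Z : T -> R) :
  is_ito_integral P F B t1 t2 H Z -> sq_integrable P Z /\ mean P Z = 0.
Proof.
case=> _ mZ [S [_ SZ]].
have sU k := (simple_integral_mean (S k)).1.
have [sZ cZ] := L2_limit mZ sU SZ.
split=> //; apply: (L2_limit_mean0 sZ sU _ cZ) => k.
by have [] := simple_integral_mean (S k).
Qed.

(** The step processes that define [Z] approximate 1, so their integrals tend to [Z]
    by definition and to the increment of [B] by [simple_integral_sub]. *)
Lemma ito_integral_one (Z : T -> R) :
  is_ito_integral P F B t1 t2 (fun _ _ => 1) Z ->
  {ae P, forall w, Z w = B t2 w - B t1 w}.
Proof.
case=> _ mZ [S [SH SZ]].
have sU k := (simple_integral_mean (S k)).1.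
have [sZ cZ] := L2_limit mZ sU SZ.
have [sD _ _] := brownian_increment hB t10 t12.
apply: (L2_limit_unique sZ sD sU cZ).
have c8 : (fun k => 8%:E * mean_square P t1 t2
    (fun s w => simple_value (S k) s w - 1)%R)%E @ \oo --> 0%E.
  by rewrite -(mule0 8%:E); apply: cvgeZl.
have /fine_cvgP[_ cD] : (fun k =>
    (mean P (fun w => (B t2 w - B t1 w - simple_integral (S k) B w) ^+ 2))%:E) @ \oo
    --> 0%E.
  apply: (squeeze_cvge _ (cvg_cst 0%E) c8); apply: nearW => k.
  rewrite lee_fin mean_ge0 => [/=|w]; last exact: sqr_ge0.
  apply: le_trans (simple_integral_sub (S k)).
  by under [X in (mean P X)%:E]eq_fun do rewrite -sqrrN opprB.
exact: cD.
Qed.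

Lemma time_integral_one (Z : T -> R) :
  is_time_integral P F t1 t2 (fun _ _ => 1) Z ->
  {ae P, forall w, Z w = t2 - t1}.
Proof.
case=> _ _; apply: filterS => w ->.
rewrite Rintegral_cst// mul1r /= lebesgue_measure_itv/= lte_fin.
case: ltP => //=; rewrite le_eqVlt => /predU1P[->|]; first by rewrite subrr.
by rewrite ltNge t12.
Qed.

End ItoIntegral.

(** * The family of driving Brownian motions *)

Section BrownianFamily.
Context {d : measure_display} {T : measurableType d} {R : realType}.
Variables (P : probability T R) (m : nat) (F : R -> set (set T)).
Variable W : 'I_m -> R -> T -> R.
Hypothesis hW : independent_brownian_motions P W.
Hypothesis hF : brownian_filtration P F W.

Lemma brownian_family_wrt al : brownian_wrt P F (W al).
Proof.
have [fF adW indW] := hF; have [/(_ al)[_ _ law _ _] _] := hW.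
split=> // [|s t s0 st X /sigma_varP XF A C mA mC]; first exact: adW.
apply: (indW s t s0 st); first exact: XF.
apply: sub_sigma_algebra; exists al => //.
exact: (sigma_varP _ (W al t \- W al s)).1 (@subset_refl _ _) C mC.
Qed.

(** Apply the product rule for the full family to the events of the two increments,
    completed by the sure event at the other indices. *)
Lemma brownian_family_independent al be s t : al != be -> 0 <= s -> s <= t ->
  independent_var P (W al t \- W al s) (W be t \- W be s).
Proof.
move=> albe s0 st A B mA mB; have [_ ind] := hW.
have sG g : sigma_algebra [set: T] (sigma_process (W g)) by exact: smallest_sigma_algebra.
have incr g C : measurable C -> sigma_process (W g) ((W g t \- W g s) @^-1` C).
  have ad r : 0 <= r -> sigma_var (W g r) `<=` sigma_process (W g).
    move=> r0 D WD; apply: sub_sigma_algebra.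
    by exists r; [rewrite /= in_itv/= r0|exact: WD].
  by have /sigma_varP := adaptedB (sG g) (ad t (le_trans s0 st)) (ad s s0); apply.
pose E g : set T := if g == al then (W al t \- W al s) @^-1` A else
  if g == be then (W be t \- W be s) @^-1` B else setT.
have GE : forall j, sigma_process (W j) (E j).
  move=> j; rewrite /E; case: eqP => [->|_]; first exact: incr.
  case: eqP => [->|_]; first exact: incr.
  by have /sigma_varP /(_ setT measurableT) := @adapted_cst _ T R _ (sG j) 0.
have := ind E GE; rewrite (bigD1 al)//= (bigD1 be) 1?eq_sym//= big1 => [|g]; last first.
  by rewrite /E => /andP[/negbTE-> /negbTE->]; rewrite probability_setT.
rewrite mulr1 EFinM {2 3}/E eqxx (negbTE (_ : be != al)) 1?eq_sym// eqxx.
have mI g C : measurable C -> measurable ((W g t \- W g s) @^-1` C).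
  have [sI _ _] := brownian_increment (brownian_family_wrt g) s0 st.
  by move=> mC; rewrite -[X in measurable X]setTI; exact: (sq_integrable_measurable sI).
rewrite !fineK ?fin_num_measure//; [|exact: mI|exact: mI].
move=> <-; congr (P _); apply/seteqP; split=> w.
  by case=> Aw Bw j _; rewrite /E; case: eqP => // _; case: eqP.
by move=> Ew; have := Ew al I; have := Ew be I; rewrite /E eq_sym !eqxx (negbTE albe).
Qed.

End BrownianFamily.

(** * Mean squares of random vectors *)

Section RandomVector.
Context {d : measure_display} {T : measurableType d} {R : realType}.
Variables (P : probability T R) (p : nat).
Implicit Types (V : T -> 'rV[R]_p) (v c : 'rV[R]_p).

Definition centered V := forall i,
  sq_integrable P (fun w => V w 0 i) /\ mean P (fun w => V w 0 i) = 0.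

Lemma centeredD V1 V2 : centered V1 -> centered V2 -> centered (fun w => V1 w + V2 w).
Proof.
move=> c1 c2 i; have [s1 m1] := c1 i; have [s2 m2] := c2 i.
under [X in sq_integrable _ X]eq_fun do rewrite mxE.
under [X in mean _ X]eq_fun do rewrite mxE.
split; first exact: sq_integrableD.
by rewrite meanD ?m1 ?m2 ?addr0//; exact: sq_integrable_integrable_var.
Qed.

Lemma centeredZ (X : T -> R) v : sq_integrable P X -> mean P X = 0 ->
  centered (fun w => X w *: v).
Proof.
move=> sX X0 i.
under [X in sq_integrable _ X]eq_fun do rewrite mxE mulrC.
under [X in mean _ X]eq_fun do rewrite mxE mulrC.
split; first exact: sq_integrableZ.
by rewrite meanZ ?X0 ?mulr0//; exact: sq_integrable_integrable_var.
Qed.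

Lemma centered_sum (J : Type) (s : seq J) (q : pred J) (V : J -> T -> 'rV[R]_p) :
  (forall j, q j -> centered (V j)) -> centered (fun w => \sum_(j <- s | q j) V j w).
Proof.
move=> cV; elim: s => [|j s IH].
  under [X in centered X]eq_fun do rewrite big_nil.
  move=> i; under [X in sq_integrable _ X]eq_fun do rewrite mxE.
  under [X in mean _ X]eq_fun do rewrite mxE.
  by split; [exact: sq_integrable_cst|exact: mean_cst].
under [X in centered X]eq_fun do rewrite big_cons.
by case: (boolP (q j)) => // qj; apply: centeredD => //; exact: cV.
Qed.

(** The cross term is linear in [V], hence has mean 0. *)
Lemma expectation_sqnorm_centered c V : centered V ->
  'E_P[fun w => sqnorm (c + V w)]%E =
  (sqnorm c + mean P (fun w => sqnorm (V w)))%:E.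
Proof.
move=> cV.
have iV2 i : integrable_var P (fun w => V w 0 i ^+ 2) by have [[]] := cV i.
have iV i : integrable_var P (fun w => V w 0 i).
  by have [/sq_integrable_integrable_var] := cV i.
have iS : integrable_var P (fun w => sqnorm (V w)) by exact: integrable_var_sum.
have iL : integrable_var P (fun w => \sum_i (2 * c 0 i) * V w 0 i).
  by apply: integrable_var_sum => i _; exact: integrable_varZ.
have -> : (fun w => sqnorm (c + V w)) =
    fun w => sqnorm c + (\sum_i (2 * c 0 i) * V w 0 i + sqnorm (V w)).
  apply/funext => w; rewrite /sqnorm -!big_split /=; apply: eq_bigr => i _.
  by rewrite mxE; ring.
rewrite expectation_mean; last first.
  by apply: integrable_varD; [exact: integrable_var_cst|exact: integrable_varD].
congr EFin; rewrite meanD; [|exact: integrable_var_cst|exact: integrable_varD].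
rewrite mean_cst meanD// mean_sum => [|i _]; last exact: integrable_varZ.
rewrite big1 ?add0r// => i _; rewrite meanZ//.
by have [_ ->] := cV i; rewrite mulr0.
Qed.

Lemma expectation_sqnorm_orthogonal (J : finType) (X : J -> T -> R) (v : J -> 'rV[R]_p) :
  (forall j, sq_integrable P (X j)) ->
  (forall j k, j != k -> mean P (fun w => X j w * X k w) = 0) ->
  'E_P[fun w => sqnorm (\sum_j X j w *: v j)]%E =
  (\sum_j mean P (fun w => X j w ^+ 2) * sqnorm (v j))%:E.
Proof.
move=> sX Xorth.
have iXX j k : integrable_var P (fun w => X j w * X k w) by exact: integrable_varM.
have -> : (fun w => sqnorm (\sum_j X j w *: v j)) =
    fun w => \sum_i \sum_j \sum_k (v j 0 i * v k 0 i) * (X j w * X k w).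
  apply/funext => w; rewrite /sqnorm; apply: eq_bigr => i _.
  rewrite summxE expr2 big_distrlr /=; apply: eq_bigr => j _; apply: eq_bigr => k _.
  by rewrite !mxE; ring.
have i1 i j k : integrable_var P (fun w => (v j 0 i * v k 0 i) * (X j w * X k w)).
  exact: integrable_varZ.
have i2 i j : integrable_var P (fun w => \sum_k (v j 0 i * v k 0 i) * (X j w * X k w)).
  exact: integrable_var_sum.
have i3 i : integrable_var P (fun w => \sum_j \sum_k (v j 0 i * v k 0 i) * (X j w * X k w)).
  exact: integrable_var_sum.
rewrite expectation_mean; last exact: integrable_var_sum.
congr EFin; rewrite mean_sum// [RHS](eq_bigr (fun j =>
  \sum_i mean P (fun w => X j w ^+ 2) * v j 0 i ^+ 2)) => [|j _]; last by rewrite mulr_sumr.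
rewrite [RHS]exchange_big /=; apply: eq_bigr => i _; rewrite mean_sum//.
apply: eq_bigr => j _; rewrite mean_sum// (bigD1 j)//= big1 => [|k kj].
  by rewrite addr0 meanZ// mulrC expr2.
by rewrite meanZ// Xorth ?mulr0// eq_sym.
Qed.

End RandomVector.

(** * Expansions of order one half and one *)

Section ItoTaylorExpansion.
Context {T : Type} {R : realType} {m p q : nat}.
Variables (I : seq 'I_m.+1 -> R -> R -> T -> R) (S : @sde R m p).
Variables (z0 : 'rV[R]_p) (f : 'rV[R]_p -> R -> 'rV[R]_q) (t : R) (w : T).
Hypothesis f0 : f z0 0 = 0.

Let term xi := I xi 0 t w *: ito_L S xi f z0 0.

(** The only multi-index of length 0 contributes [f z0 0 = 0]. *)
Let sum_term0 k :
  \sum_(xi : 0.-tuple 'I_m.+1 | (0 + count_mem ord0 xi <= k)%N) term xi = 0.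
Proof. by apply: big1 => xi _; rewrite tuple0 /term /= f0 scaler0. Qed.

Let tuple1 (xi : 1.-tuple 'I_m.+1) : xi = [tuple thead xi].
Proof. by case/tupleP: xi => i s; rewrite (tuple0 s); exact/val_inj. Qed.

Let sum_term1 (Q : pred 'I_m.+1) :
  \sum_(xi : 1.-tuple 'I_m.+1 | Q (thead xi)) term xi = \sum_(i | Q i) term [:: i].
Proof.
rewrite (reindex (fun i : 'I_m.+1 => [tuple i])) /=; first exact: eq_bigl.
by exists (fun xi => thead xi) => xi _; rewrite // [RHS]tuple1.
Qed.

(** A zero counts twice in the weight [l + n], so the indices of weight at most 1
    are the empty one and the single noise indices. *)
Lemma ito_taylor_half : ito_taylor I S z0 f 1 t w =
  \sum_al I [:: lift ord0 al] 0 t w *: ito_L1 S (lift ord0 al) f z0 0.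
Proof.
rewrite /ito_taylor !big_ord_recr big_ord0 /= sum_term0 !add0r.
rewrite (eq_bigl (fun xi : 1.-tuple _ => thead xi != ord0)) => [|xi].
  by rewrite (sum_term1 (fun i => i != ord0)) big_mkcond big_ord_recl /= add0r.
by rewrite [in LHS](tuple1 xi) /= addn0; case: (thead xi == ord0).
Qed.

(** The indices of weight at most 2 are the empty one, the single indices, and the
    pairs of noise indices. *)
Lemma ito_taylor_one : ito_taylor I S z0 f 2 t w =
  I [:: ord0] 0 t w *: ito_L1 S ord0 f z0 0 +
  (\sum_al I [:: lift ord0 al] 0 t w *: ito_L1 S (lift ord0 al) f z0 0 +
   \sum_(xi : 2.-tuple 'I_m.+1 | count_mem ord0 xi == 0%N)
      I xi 0 t w *: ito_L S xi f z0 0).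
Proof.
rewrite /ito_taylor !big_ord_recr big_ord0 /= sum_term0 !add0r addrA.
congr (_ + _); last by apply: eq_bigl => xi; case: (count_mem _ _).
rewrite (eq_bigl (fun xi : 1.-tuple _ => predT (thead xi))) => [|xi].
  by rewrite (sum_term1 predT) big_ord_recl.
by rewrite [in LHS](tuple1 xi) /= addn0; case: (thead xi == ord0).
Qed.

(** The operators of the noise indices involve the diffusion coefficients only. *)
Lemma ito_L_diffusion (S' : @sde R m p) xi : diffusion S = diffusion S' ->
  count_mem ord0 xi = 0%N -> ito_L S xi f = ito_L S' xi f.
Proof.
move=> SS'; elim: xi; first by [].
move=> i xi IH xi0.
have [al -> /IH E] : exists2 al, i = lift ord0 al & count_mem ord0 xi = 0%N.
  move: xi0 => {IH} /=; case: (unliftP ord0 i) => [al ->|->].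
    by rewrite eq_sym (negbTE (neq_lift _ _)); exists al.
  by rewrite eqxx.
have -> : ito_L S (lift ord0 al :: xi) f = ito_L1 S (lift ord0 al) (ito_L S xi f) by [].
have -> : ito_L S' (lift ord0 al :: xi) f = ito_L1 S' (lift ord0 al) (ito_L S' xi f) by [].
by rewrite E /ito_L1 liftK SS'.
Qed.

End ItoTaylorExpansion.

(** * Iterated integrals of the constant 1 *)

Section IteratedIntegrals.
Context {d : measure_display} {T : measurableType d} {R : realType}.
Variables (P : probability T R) (m : nat) (F : R -> set (set T)).
Variable W : 'I_m -> R -> T -> R.
Hypothesis hW : independent_brownian_motions P W.
Hypothesis hF : brownian_filtration P F W.
Variable I : seq 'I_m.+1 -> R -> R -> T -> R.
Hypothesis hI : is_iterated_integrals P F W (fun _ _ => 1) I.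
Variable t : R.
Hypothesis t0 : 0 <= t.

Lemma iterated_integral_centered xi al :
  sq_integrable P (I (rcons xi (lift ord0 al)) 0 t) /\
  mean P (I (rcons xi (lift ord0 al)) 0 t) = 0.
Proof.
have := hI.2 xi (lift ord0 al) 0 t (lexx _) t0; rewrite /is_integral_dW liftK.
move=> It; exact: (ito_integral_mean (brownian_family_wrt hW hF al) (lexx _) It).
Qed.

Let I0 : I [::] 0 = fun _ _ => 1.
Proof. by apply/funext => s; exact: hI.1. Qed.

Lemma noise_integral al :
  {ae P, forall w, I [:: lift ord0 al] 0 t w = W al t w - W al 0 w}.
Proof.
have := hI.2 [::] (lift ord0 al) 0 t (lexx _) t0; rewrite /is_integral_dW liftK I0.
exact: (ito_integral_one (brownian_family_wrt hW hF al) (lexx _) t0).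
Qed.

Lemma time_integral : measurable_fun [set: T] (I [:: ord0] 0 t) /\
  {ae P, forall w, I [:: ord0] 0 t w = t}.
Proof.
have := hI.2 [::] ord0 0 t (lexx _) t0; rewrite /is_integral_dW unlift_none I0.
move=> It; split; first by case: It.
by apply: filterS (time_integral_one t0 It) => w ->; rewrite subr0.
Qed.

Lemma noise_integral_orthogonal al be : al != be ->
  mean P (fun w => I [:: lift ord0 al] 0 t w * I [:: lift ord0 be] 0 t w) = 0.
Proof.
move=> albe.
have [sa ma _] := brownian_increment (brownian_family_wrt hW hF al) (lexx _) t0.
have [sb mb _] := brownian_increment (brownian_family_wrt hW hF be) (lexx _) t0.
have [_ E] := independent_meanM
  (brownian_family_independent hW hF albe (lexx _) t0)
  (sq_integrable_integrable_var sa) (sq_integrable_integrable_var sb).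
have [sIa _] := iterated_integral_centered [::] al.
have [sIb _] := iterated_integral_centered [::] be.
rewrite ma mul0r in E; rewrite -[RHS]E; apply: mean_ae_eq.
- by apply: filterS2 (noise_integral al) (noise_integral be) => w -> ->.
- by apply: measurable_funM; [case: sIa|case: sIb].
- by apply: measurable_funM; [case: sa|case: sb].
Qed.

Lemma noise_integral_variance_gt0 al : 0 < t ->
  0 < mean P (fun w => I [:: lift ord0 al] 0 t w ^+ 2).
Proof.
move=> tgt0; have Wal := brownian_family_wrt hW hF al.
have [sa _ _] := brownian_increment Wal (lexx _) t0.
have [sIa _] := iterated_integral_centered [::] al.
rewrite (_ : mean _ _ = mean P (fun w => (W al t \- W al 0) w ^+ 2)).
  have sq0 : 0 < Num.sqrt (t - 0) by rewrite subr0 sqrtr_gt0.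
  apply: (normal_variance_gt0 (sq_integrable_measurable sa) sq0) => C mC.
  by case: Wal => _ _ law _; exact: law.
apply: mean_ae_eq; first by apply: filterS (noise_integral al) => w ->.
- by apply: measurable_funX; case: sIa.
- by apply: measurable_funX; case: sa.
Qed.

End IteratedIntegrals.

(** * The optimal coefficients *)

Theorem theorem1
  (R : realType) (d : measure_display) (T : measurableType d)
  (P : probability T R)
  (m r n : nat)
  (F : R -> set (set T)) (W : 'I_m -> R -> T -> R)
  (hW : independent_brownian_motions P W)
  (hF : brownian_filtration P F W)
  (I : seq 'I_m.+1 -> R -> R -> T -> R)
  (hI : is_iterated_integrals P F W (fun _ _ => 1) I)
  (M : set 'rV[R]_r) (hM : submanifold n M)
  (U : set 'rV[R]_r) (psi : 'rV[R]_r -> 'rV[R]_n) (phi : 'rV[R]_n -> 'rV[R]_r)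
  (hchart : is_chart M U psi phi)
  (a : 'rV[R]_r -> R -> 'rV[R]_r) (b : 'I_m -> 'rV[R]_r -> R -> 'rV[R]_r)
  (X0 : 'rV[R]_r) (hX0 : U X0)
  (t : R) (ht : 0 < t) :
  let Y0 := psi X0 in
  let Pi (y : 'rV[R]_n) := orth_proj (tangent_space phi y) in
  let gap (z : 'rV[R]_(r + n)) (_ : R) := lsubmx z - phi (rsubmx z) in
  (* k is twice the order of the expansion of X_t - phi(Y_t) *)
  let err (k : nat) (A : 'rV[R]_n -> R -> 'rV[R]_n)
      (B : 'I_m -> 'rV[R]_n -> R -> 'rV[R]_n) : \bar R :=
    'E_P[fun w => sqnorm
           (ito_taylor I (stacked_sde (SDE a b) (SDE A B)) (row_mx X0 Y0) gap k t w)]%E in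
  (forall (A : 'rV[R]_n -> R -> 'rV[R]_n)
          (B : 'I_m -> 'rV[R]_n -> R -> 'rV[R]_n),
     (forall A' B', (err 1%N A B <= err 1%N A' B')%E)
     <-> (forall al, B al Y0 0 = psi_star phi Y0 (Pi Y0 (b al X0 0))))
  /\
  (forall (A : 'rV[R]_n -> R -> 'rV[R]_n)
          (B : 'I_m -> 'rV[R]_n -> R -> 'rV[R]_n),
     (forall al (i : 'I_r), derivable (fun x => b al x 0) X0 'e_i) ->
     (forall al (i : 'I_n), derivable (fun y => B al y 0) Y0 'e_i) ->
     (forall al y, (psi @` U) y ->
        B al y 0 = psi_star phi y (Pi y (b al (phi y) 0))) ->
     (forall A', (err 2%N A B <= err 2%N A' B)%E)
     <-> A Y0 0 =
         psi_star phi Y0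
           (Pi Y0 (a X0 0 - 2^-1 *: \sum_al \sum_be
              gE al be *: nabla_diff phi Y0 (B al Y0 0) (B be Y0 0)))).
Proof.
move=> Y0 Pi gap err; set X := SDE a b.
have Vy0 : (psi @` U) Y0 by exists X0.
have oV := chart_img_open hchart.
have phiC2 : Ck_on 2 (psi @` U) phi by exact: (chart_inv_smooth hchart 2).
have Jfree : row_free ('J phi Y0) by exact: (chart_immersion hchart Vy0).
have gap0 : gap (row_mx X0 Y0) 0 = 0.
  by rewrite /gap row_mxKl row_mxKr (chart_inv hchart hX0) subrr.
pose noise al w := I [:: lift ord0 al] 0 t w.
have t0 := ltW ht.
have sN al : sq_integrable P (noise al).
  by have [] := iterated_integral_centered hW hF hI t0 [::] al.
have N0 al : mean P (noise al) = 0.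
  by have [] := iterated_integral_centered hW hF hI t0 [::] al.
have err1E A B : err 1%N A B =
    (\sum_al mean P (fun w => noise al w ^+ 2) *
       sqnorm (b al X0 0 - B al Y0 0 *m 'J phi Y0))%:E.
  rewrite /err -expectation_sqnorm_orthogonal//; last first.
    by move=> al be; exact: (noise_integral_orthogonal hW hF hI t0).
  congr expectation; apply/funext => w; rewrite ito_taylor_half//.
  congr sqnorm; apply: eq_bigr => al _.
  by rewrite (ito_gap_noise phiC2 X (SDE A B) X0 Vy0).
split.
  move=> A B; split=> [minB al|BE A' B']; last first.
    rewrite !err1E lee_fin; apply: ler_sum => al _.
    rewrite ler_wpM2l ?mean_ge0// => [w|]; first exact: sqr_ge0.
    by rewrite BE; exact: sqnorm_sub_proj_le.
  (* Compare with the coefficients that differ from [B] at the index [al] alone, where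
     they take the optimal value. *)
  pose B' al' (y : 'rV[R]_n) (s : R) :=
    if al' == al then psi_star phi Y0 (Pi Y0 (b al X0 0)) else B al' y s.
  have := minB A B'; rewrite !err1E lee_fin (bigD1 al)//= [leRHS](bigD1 al)//=.
  rewrite [X in _ <= _ + X](eq_bigr (fun al' => mean P (fun w => noise al' w ^+ 2) *
    sqnorm (b al' X0 0 - B al' Y0 0 *m 'J phi Y0))) => [|al' /negbTE al'al]; last first.
    by rewrite /B' al'al.
  rewrite lerD2r ler_pM2l; last exact: (noise_integral_variance_gt0 hW hF hI t0 al ht).
  rewrite /B' eqxx; exact: sqnorm_sub_proj_uniq.
move=> A B _ _ _.
set v := a X0 0 - _.
pose S A' := stacked_sde X (SDE A' B).
have driftE A' : ito_L1 (S A') ord0 gap (row_mx X0 Y0) 0 = v - A' Y0 0 *m 'J phi Y0.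
  exact: (ito_gap_drift oV phiC2 X (SDE A' B) X0 Vy0).
have noiseE A' al : ito_L1 (S A') (lift ord0 al) gap (row_mx X0 Y0) 0 =
    ito_L1 (S A) (lift ord0 al) gap (row_mx X0 Y0) 0.
  by rewrite /ito_L1 liftK.
have itoE A' (xi : 2.-tuple 'I_m.+1) : count_mem ord0 xi == 0%N ->
    ito_L (S A') xi gap (row_mx X0 Y0) 0 = ito_L (S A) xi gap (row_mx X0 Y0) 0.
  by move=> /eqP xi0; rewrite (@ito_L_diffusion _ _ _ _ (S A') gap (S A) xi).
(* The part of the expansion without the index [(0)]; by [noiseE] and [itoE] it is
   the same for all drifts. *)
pose V w := \sum_al noise al w *: ito_L1 (S A) (lift ord0 al) gap (row_mx X0 Y0) 0 +
   \sum_(xi : 2.-tuple 'I_m.+1 | count_mem ord0 xi == 0%N)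
      I xi 0 t w *: ito_L (S A) xi gap (row_mx X0 Y0) 0.
have cV : centered P V.
  apply: centeredD; first by apply: centered_sum => al _; exact: centeredZ.
  apply: centered_sum => xi xi0.
  suff [s m0] : sq_integrable P (I xi 0 t) /\ mean P (I xi 0 t) = 0 by exact: centeredZ.
  case/tupleP: xi xi0 => i xi; case/tupleP: xi => j xi; rewrite (tuple0 xi) /=.
  case: (unliftP ord0 j) => [be ->|->]; last by rewrite eqxx addnC.
  by move=> _; exact: (iterated_integral_centered hW hF hI t0 [:: i]).
have [mI It] := time_integral hI t0.
have err2E A' : err 2%N A' B =
    (t ^+ 2 * sqnorm (v - A' Y0 0 *m 'J phi Y0) + mean P (fun w => sqnorm (V w)))%:E.
  rewrite -sqnormZ -expectation_sqnorm_centered// /err.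
  have -> : (fun w => sqnorm (ito_taylor I (S A') (row_mx X0 Y0) gap 2 t w)) =
      fun w => sqnorm (I [:: ord0] 0 t w *: (v - A' Y0 0 *m 'J phi Y0) + V w).
    apply/funext => w; rewrite (ito_taylor_one _ _ _ _ gap0) driftE.
    congr (sqnorm (_ + _)); rewrite /V; apply: (f_equal2 (fun x y : 'rV[R]_r => x + y)).
      by apply: eq_bigr => al _; rewrite noiseE.
    by apply: eq_bigr => xi xi0; rewrite itoE.
  have mV i : measurable_fun [set: T] (fun w => V w 0 i) by have [[]] := cV i.
  have mS (X' : T -> R) : measurable_fun [set: T] X' ->
      measurable_fun [set: T] (fun w => sqnorm (X' w *: (v - A' Y0 0 *m 'J phi Y0) + V w)).
    move=> mX; apply: measurable_sum => i; apply: measurable_funX.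
    under eq_fun do rewrite 2!mxE.
    by apply: measurable_funD => //; exact: measurable_funM.
  rewrite unlock; apply: ae_eq_integral => //.
  - by apply/measurable_EFinP; exact: mS.
  - by apply/measurable_EFinP; exact: mS.
  - by apply: filterS It => w /= ->.
have t2 : 0 < t ^+ 2 by rewrite exprn_gt0.
split=> [minA|AE A']; last first.
  by rewrite !err2E lee_fin lerD2r ler_pM2l// AE; exact: sqnorm_sub_proj_le.
have := minA (fun _ _ => psi_star phi Y0 (Pi Y0 v)).
rewrite !err2E lee_fin lerD2r ler_pM2l//; exact: sqnorm_sub_proj_uniq.
Qed.
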